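(* Let $\mathbb G$ be an algebraic quantum group of compact type and let $(N,\theta,\hat\theta)$ be a unital braided commutative Yetter--Drinfeld $\mathbb G^{c}$-$*$-algebra. Define linear maps $\gamma_\theta,\hat\gamma_\theta:N\to N$ by $$\gamma_\theta(m)=m_{[0]}\lhd S^{-1}(m_{[-1]}),\qquad \hat\gamma_\theta(m)=m_{[0]}\lhd S^{2}(m_{[-1]}).$$ Then: (CA1) $*\circ\gamma_\theta=\hat\gamma_\theta\circ *$, $\ \theta\circ\gamma_\theta=(S_{\mathbb G^c}^{2}\otimes\gamma_\theta)\circ\theta$ and $\theta\circ\hat\gamma_\theta=(S_{\mathbb G^c}^{-2}\otimes\hat\gamma_\theta)\circ\theta$. (CA2) $\gamma_\theta(m\lhd h)=\gamma_\theta(m)\lhd S^{-2}(h)$ and $\hat\gamma_\theta(m\lhd h)=\hat\gamma_\theta(m)\lhd S^{2}(h)$ for all $m\in N$, $h\in\mathcal O(\mathbb G)$. (CA3) $(m_{[0]}n)\lhd S^{-1}(m_{[-1]})=n\,\gamma_\theta(m)$ and $(nm_{[0]})\lhd S^{2}(m_{[-1]})=\hat\gamma_\theta(m)\,n$ for all $m,n\in N$. (CA4) $\gamma_\theta(\hat\gamma_\theta(m))=m$ and $\hat\gamma_\theta(\gamma_\theta(m))=m$ for all $m\in N$. (CA5) $\gamma_\theta(mn)=\gamma_\theta(m)\gamma_\theta(n)$ and $\hat\gamma_\theta(mn)=\hat\gamma_\theta(m)\hat\gamma_\theta(n)$ for all $m,n\in N$. (CA6) $\gamma_\theta(\gamma_\theta(m^*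 )^* )=m$ and $\hat\gamma_\theta(\hat\gamma_\theta(m^* )^* )=m$ for all $m\in N$. (CA7) $\hat\theta\circ\gamma_\theta=(\hat S^{2}\otimes\gamma_\theta)\circ\hat\theta$ and $\hat\theta\circ\hat\gamma_\theta=(\hat S^{-2}\otimes\hat\gamma_\theta)\circ\hat\theta$. (CA8) $\gamma_\theta(m\lhd_\theta\omega)=\gamma_\theta(m)\lhd_\theta\hat S^{2}(\omega)$ and $\hat\gamma_\theta(m\lhd_\theta\omega)=\hat\gamma_\theta(m)\lhd_\theta\hat S^{-2}(\omega)$ for all $m\in N$, $\omega\in\widehat{\mathcal O(\mathbb G)}$. (CA9) If $\mu$ is a nonzero $\hat\theta$-invariant linear functional on $N$, then $\mu=\mu\circ\gamma_\theta=\mu\circ\hat\gamma_\theta$ and $\mu(mn)=\mu(n\gamma_\theta(m))=\mu(\hat\gamma_\theta(n)m)$ for all $m,n\in N$.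
   Context: Algebraic quantum group of compact type $\mathbb G$: a unital Hopf $*$-algebra $\mathcal O(\mathbb G)$ over $\mathbb C$ (coproduct $\Delta$, counit $\varepsilon$, antipode $S$, which is bijective with $S\circ *\circ S\circ *=\mathrm{id}$) together with a nonzero positive ($\varphi(hh^* )\ge 0$) faithful linear functional $\varphi$ with $(\mathrm{id}\otimes\varphi)\Delta(h)=\varphi(h)1=(\varphi\otimes\mathrm{id})\Delta(h)$. Sweedler notation: $\Delta(h)=h_{(1)}\otimes h_{(2)}$. The dual algebra is $\widehat{\mathcal O(\mathbb G)}=\{h\cdot\varphi: h\in\mathcal O(\mathbb G)\}$, $(h\cdot\varphi)(g)=\varphi(gh)$, with pairing $\mathbf p(h,\omega)=\omega(h)$, product $\mathbf p(h,\omega\omega')=\mathbf p(h_{(1)},\omega)\mathbf p(h_{(2)},\omega')$ and antipode $\mathbf p(h,\hat S(\omega))=\mathbf p(S(h),\omega)$; its comultiplication $\hat\Delta:\widehat{\mathcal O(\mathbb G)}\to\mathrm M(\widehat{\mathcal O(\mathbb G)}\otimes\widehat{\mathcal O(\mathbb G)})$ ($\mathrm M$ = multiplier algebra) is dual to the product of $\mathcal O(\mathbb G)$. The slice map $\mathbf p(h,\cdot)\otimes\mathrm{id}$ is extended to $\mathrm M(\widehat{\mathcal O(\mathbb G)}\otimes N)$ by $(\mathbf p(h,\cdot)\otimes\mathrm{id})(T)=(\mathbf p(h,\cdot)\otimes\mathrm{id})(T(\chi\otimes 1))$ for any $\chi$ with $h_{(1)}\mathbf p(h_{(2)},\chi)=h$.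 $\mathbb G^c$ denotes $\mathcal O(\mathbb G)^{op}$ (opposite product, same coproduct), with involution $(h^{op})^*=S^{-2}(h^* )^{op}$ and antipode $S_{\mathbb G^c}(h^{op})=S^{-1}(h)^{op}$. A unital braided commutative Yetter--Drinfeld $\mathbb G^c$-$*$-algebra $(N,\theta,\hat\theta)$ consists of: - a unital $*$-algebra $N$ over $\mathbb C$; - a right action $\theta$ of $\mathbb G^c$, i.e. a unital $*$-homomorphism $\theta:N\to\mathcal O(\mathbb G)^{op}\otimes N$, written $\theta(m)=m_{[-1]}^{op}\otimes m_{[0]}$, with $m_{[-1](1)}\otimes m_{[-1](2)}\otimes m_{[0]}=m_{[-1]}\otimes m_{[0][-1]}\otimes m_{[0][0]}$ and $\varepsilon(m_{[-1]})m_{[0]}=m$; - a right action $\hat\theta:N\to\mathrm M(\widehat{\mathcal O(\mathbb G)}\otimes N)$ of the dual, i.e. a left coaction of $(\widehat{\mathcal O(\mathbb G)},\hat\Delta)$ by a unital $*$-homomorphism; it is equivalent to the right action $m\lhd h:=(\mathbf p(h,\cdot)\otimes\mathrm{id})\hat\theta(m)$ of $\mathcal O(\mathbb G)$ on $N$, which makes $N$ a unital right $\mathcal O(\mathbb G)$-module with $(mn)\lhd h=(m\lhd h_{(1)})(n\lhd h_{(2)})$, $1\lhd h=\varepsilon(h)1$, $(m\lhd h)^*=m^*\lhd S(h)^*$; such that, for all $m,n\in N$, $h\in\mathcal O(\mathbb G)$, $$\theta(m\lhd h)=(S^{-1}(h_{(3)})m_{[-1]}h_{(1)})^{op}\otimes(m_{[0]}\lhd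 h_{(2)}),$$ $$mn=(n\lhd m_{[-1]})m_{[0]}=n_{[0]}(m\lhd S(n_{[-1]})).$$ Also $m\lhd_\theta\omega:=\mathbf p(m_{[-1]},\omega)m_{[0]}$. A functional $\mu$ on $N$ is $\hat\theta$-invariant if $(\mathrm{id}\otimes\mu)((\omega\otimes1)\hat\theta(m))=\mu(m)\omega$ for all $\omega, m$; equivalently $\mu(m\lhd h)=\varepsilon(h)\mu(m)$ for all $m,h$. *)

(* Defs.v *)
From HB Require Import structures.
From mathcomp Require Import all_boot all_order all_algebra.
From mathcomp Require Import generic_quotient.
From mathcomp Require Import boolp classical_sets functions reals.
From mathcomp Require Import ring.
From mathcomp Require Export complex.

Set Implicit Arguments.
Unset Strict Implicit.
Unset Printing Implicit Defensive.
Import Order.TTheory GRing.Theory Num.Theory.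
Local Open Scope ring_scope.
Local Open Scope quotient_scope.

(* The library has no tensor product of modules of infinite rank.  [tens A B]
   is the quotient of the finite formal sums of pure tensors (sequences of
   pairs) by equality under every biadditive balanced map to an abelian group.
   Balanced maps rather than bilinear ones are used so that the universal
   property also covers semilinear maps, such as the involutions. *)

Record balanced (K : comPzRingType) (A B : lmodType K) (V : zmodType)
    (f : A -> B -> V) : Prop := Balanced {
  balancedDl : forall a a' b, f (a + a') b = f a b + f a' b;
  balancedDr : forall a b b', f a (b + b') = f a b + f a b';
  balancedZ : forall k a b, f (k *: a) b = f a (k *: b) }.

Section TensorType.
Variables (K : comPzRingType) (A B : lmodType K).

Definition fsum (V : zmodType) (f : A -> B -> V) (s : seq (A * B)) : V :=
  \sum_(p <- s) f p.1 p.2.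

Definition teq (s t : seq (A * B)) : bool :=
  `[< forall (V : zmodType) (f : A -> B -> V),
        balanced f -> fsum f s = fsum f t >].

Lemma teq_refl : reflexive teq.
Proof. by move=> s; apply/asboolP. Qed.

Lemma teq_sym : symmetric teq.
Proof.
by move=> s t; apply/asboolP/asboolP => H V f bf; rewrite (H V f bf).
Qed.

Lemma teq_trans : transitive teq.
Proof.
move=> t s u /asboolP st /asboolP tu; apply/asboolP => V f bf.
by rewrite (st V f bf) (tu V f bf).
Qed.

Canonical teq_equiv := EquivRel teq teq_refl teq_sym teq_trans.

Definition tens := {eq_quot teq}.

HB.instance Definition _ : EqQuotient _ teq tens := EqQuotient.on tens.
HB.instance Definition _ := Choice.on tens.

End TensorType.

(* Sweedler sum: the value at [t] of the map induced by [f]; see [tsum_tens]. *)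
Definition tsum (K : comPzRingType) (A B : lmodType K) (V : zmodType)
  (t : tens A B) (f : A -> B -> V) : V := fsum f (repr t).

Notation "'\tsum_' ( a , b <- t ) E" := (tsum t (fun a b => E))
  (at level 36, E at level 36, a name, b name, t at level 51,
   format "'\tsum_' ( a ,  b  <-  t )  E") : ring_scope.

Section TensorModule.
Variables (K : comPzRingType) (A B : lmodType K).
Implicit Types (x y z : tens A B).

Definition tpure (a : A) (b : B) : tens A B := \pi_(tens A B) [:: (a, b)].

Lemma tsum_pi (V : zmodType) (f : A -> B -> V) (s : seq (A * B)) :
  balanced f -> tsum (\pi_(tens A B) s) f = fsum f s.
Proof.
move=> bf; rewrite /tsum; have /eqmodP/asboolP := reprK (\pi_(tens A B) s).
exact.
Qed.

Lemma tsum_tens (V : zmodType) (f : A -> B -> V) a b :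
  balanced f -> tsum (tpure a b) f = f a b.
Proof. by move=> bf; rewrite tsum_pi // /fsum big_seq1. Qed.

Lemma tensP x y :
  (forall (V : zmodType) (f : A -> B -> V), balanced f -> tsum x f = tsum y f) ->
  x = y.
Proof.
by move=> H; rewrite -[x]reprK -[y]reprK; apply/eqmodP/asboolP => V f /H.
Qed.

Definition tzero : tens A B := \pi_(tens A B) [::].
Definition tadd x y : tens A B := \pi_(tens A B) (repr x ++ repr y).
Definition topp x : tens A B := \pi_(tens A B) [seq (- p.1, p.2) | p <- repr x].
Definition tscale (k : K) x : tens A B := \pi_(tens A B) [seq (k *: p.1, p.2) | p <- repr x].

Lemma balanced0l (V : zmodType) (f : A -> B -> V) b : balanced f -> f 0 b = 0.
Proof. by move=> bf; apply: (@addrI _ (f 0 b)); rewrite -balancedDl ?addr0. Qed.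

Lemma balancedNl (V : zmodType) (f : A -> B -> V) a b :
  balanced f -> f (- a) b = - f a b.
Proof.
by move=> bf; apply: (@addrI _ (f a b)); rewrite -balancedDl // !subrr balanced0l.
Qed.

Lemma balanced_scale (V : zmodType) (f : A -> B -> V) (k : K) :
  balanced f -> balanced (fun a b => f (k *: a) b).
Proof.
move=> bf; split=> [a a' b|a b b'|l a b].
- by rewrite scalerDr balancedDl.
- by rewrite balancedDr.
- by rewrite -balancedZ // !scalerA mulrC.
Qed.

Lemma tsum_zero (V : zmodType) (f : A -> B -> V) : balanced f -> tsum tzero f = 0.
Proof. by move=> bf; rewrite tsum_pi // /fsum big_nil. Qed.

Lemma tsum_add (V : zmodType) (f : A -> B -> V) x y :
  balanced f -> tsum (tadd x y) f = tsum x f + tsum y f.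
Proof. by move=> bf; rewrite tsum_pi // /tsum /fsum big_cat. Qed.

Lemma tsum_opp (V : zmodType) (f : A -> B -> V) x :
  balanced f -> tsum (topp x) f = - tsum x f.
Proof.
move=> bf; rewrite tsum_pi // /tsum /fsum big_map /= -sumrN.
by apply: eq_bigr => p _; rewrite balancedNl.
Qed.

Lemma tsum_scale (V : zmodType) (f : A -> B -> V) k x :
  balanced f -> tsum (tscale k x) f = tsum x (fun a b => f (k *: a) b).
Proof. by move=> bf; rewrite tsum_pi // /tsum /fsum big_map. Qed.

Fact taddA : associative tadd.
Proof. by move=> x y z; apply: tensP => V f bf; rewrite !tsum_add // addrA. Qed.
Fact taddC : commutative tadd.
Proof. by move=> x y; apply: tensP => V f bf; rewrite !tsum_add // addrC. Qed.
Fact tadd0 : left_id tzero tadd.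
Proof. by move=> x; apply: tensP => V f bf; rewrite tsum_add // tsum_zero // add0r. Qed.
Fact taddN : left_inverse tzero topp tadd.
Proof.
move=> x; apply: tensP => V f bf.
by rewrite tsum_add // tsum_opp // tsum_zero // addNr.
Qed.

HB.instance Definition _ :=
  GRing.isZmodule.Build (tens A B) taddA taddC tadd0 taddN.

Fact tscaleA k l x : tscale k (tscale l x) = tscale (k * l) x.
Proof.
apply: tensP => V f bf; rewrite !tsum_scale //; last exact: balanced_scale.
by rewrite /tsum /fsum; apply: eq_bigr => p _; rewrite scalerA mulrC.
Qed.
Fact tscale1 : left_id 1 tscale.
Proof.
move=> x; apply: tensP => V f bf; rewrite !tsum_scale //.
by rewrite /tsum /fsum; apply: eq_bigr => p _; rewrite scale1r.
Qed.
Fact tscaleDr : right_distributive tscale +%R.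
Proof.
move=> k x y; apply: tensP => V f bf.
by rewrite tsum_add // !tsum_scale // tsum_add //; apply: balanced_scale.
Qed.
Fact tscaleDl x : {morph (fun k => tscale k x) : k l / k + l}.
Proof.
move=> k l; apply: tensP => V f bf.
rewrite tsum_add // !tsum_scale // /tsum /fsum -big_split.
by apply: eq_bigr => p _; rewrite scalerDl balancedDl.
Qed.

HB.instance Definition _ :=
  GRing.Zmodule_isLmodule.Build K (tens A B) tscaleA tscale1 tscaleDr tscaleDl.

Lemma pure_balanced : balanced tpure.
Proof.
split=> [a a' b|a b b'|k a b]; apply: tensP => V f bf; last first.
- by rewrite !tsum_tens // balancedZ.
- by rewrite [RHS]tsum_add // !tsum_tens // balancedDr.
- by rewrite [RHS]tsum_add // !tsum_tens // balancedDl.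
Qed.

Lemma pureZl k a b : tpure (k *: a) b = k *: tpure a b.
Proof.
apply: tensP => V f bf; rewrite [RHS]tsum_scale // !tsum_tens //.
exact: balanced_scale.
Qed.

End TensorModule.

Notation "a ⊗ b" := (tpure a b) (at level 38, left associativity) : ring_scope.

Section TensorOperations.
Variable K : comPzRingType.

Definition tmap (A A' B B' : lmodType K) (f : A -> A') (g : B -> B')
    (x : tens A B) : tens A' B' :=
  \tsum_(a, b <- x) (f a ⊗ g b).

Definition tassoc (A B D : lmodType K) (x : tens (tens A B) D) :
    tens A (tens B D) :=
  \tsum_(y, d <- x) \tsum_(a, b <- y) (a ⊗ (b ⊗ d)).

Definition tmul (A B : lmodType K) (mA : A -> A -> A) (mB : B -> B -> B)
    (x y : tens A B) : tens A B :=
  \tsum_(a, b <- x) \tsum_(a', b' <- y) (mA a a' ⊗ mB b b').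

End TensorOperations.

(* Unital star-algebras: [algType] is not used because it excludes the zero algebra. *)

HB.mixin Record isStarAlg (C : numClosedFieldType) A of GRing.Lmodule C A := {
  amul : A -> A -> A;
  aone : A;
  amulA : associative amul;
  amul1x : left_id aone amul;
  amulx1 : right_id aone amul;
  amulDl : left_distributive amul +%R;
  amulDr : right_distributive amul +%R;
  ascaleAl : forall (k : C) x y, k *: amul x y = amul (k *: x) y;
  ascaleAr : forall (k : C) x y, k *: amul x y = amul x (k *: y);
  star : A -> A;
  starK : involutive star;
  starD : forall x y, star (x + y) = star x + star y;
  starZ : forall (k : C) x, star (k *: x) = k^* *: star x;
  amul_star : forall x y, star (amul x y) = amul (star y) (star x)
}.

#[short(type="starAlgType")]
HB.structure Definition StarAlg (C : numClosedFieldType) :=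
  {A of GRing.Lmodule C A & isStarAlg C A}.

HB.instance Definition _ (C : numClosedFieldType) (A : starAlgType C) :=
  GRing.Zmodule_isPzRing.Build (StarAlg.sort A)
    amulA amul1x amulx1 amulDl amulDr.

Record hopfStarAlg (C : numClosedFieldType) := HopfStarAlg {
  hopf_alg :> starAlgType C;
  comul : {linear hopf_alg -> tens hopf_alg hopf_alg};
  counit : {scalar hopf_alg};
  antipode : {linear hopf_alg -> hopf_alg};
  antipodeV : hopf_alg -> hopf_alg;
  comul1 : comul 1 = (1 : hopf_alg) ⊗ (1 : hopf_alg);
  comulM : forall x y : hopf_alg, comul (x * y) = tmul amul amul (comul x) (comul y);
  comul_star : forall x, comul (star x) = tmap star star (comul x);
  coassoc : forall x,
    tassoc (tmap comul id (comul x)) = tmap id comul (comul x);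
  counit1 : counit 1 = 1;
  counitM : forall x y : hopf_alg, counit (x * y) = counit x * counit y;
  counitl : forall x, \tsum_(a, b <- comul x) (counit a *: b) = x;
  counitr : forall x, \tsum_(a, b <- comul x) (counit b *: a) = x;
  antipodel : forall x,
    \tsum_(a, b <- comul x) (antipode a * b) = counit x *: (1 : hopf_alg);
  antipoder : forall x,
    \tsum_(a, b <- comul x) (a * antipode b) = counit x *: (1 : hopf_alg);
  antipodeK : cancel antipode antipodeV;
  antipodeVK : cancel antipodeV antipode;
  antipode_star : forall x, antipode (star (antipode (star x))) = x
}.

(* The Hopf star-algebra O(G) of an algebraic quantum group G of compact type,
   with its Haar functional; faithfulness is non-degeneracy of haar (x * y). *)
Record cqg (C : numClosedFieldType) := Cqg {
  cqg_hopf :> hopfStarAlg C;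
  haar : {scalar cqg_hopf};
  haar_neq0 : exists x, haar x != 0;
  haar_ge0 : forall x : cqg_hopf, 0 <= haar (x * star x);
  haar_faithfull : forall x : cqg_hopf,
    (forall y : cqg_hopf, haar (x * y) = 0) -> x = 0;
  haar_faithfulr : forall x : cqg_hopf,
    (forall y : cqg_hopf, haar (y * x) = 0) -> x = 0;
  haar_invl : forall x, \tsum_(a, b <- comul _ x) (haar b *: a) = haar x *: (1 : cqg_hopf);
  haar_invr : forall x, \tsum_(a, b <- comul _ x) (haar a *: b) = haar x *: (1 : cqg_hopf)
}.

Arguments comul {C h}.
Arguments counit {C h}.
Arguments antipode {C h}.
Arguments haar {C c}.

Section SweedlerCalculus.
Variables (K : comPzRingType) (A B : lmodType K).

Lemma eq_tsum (V : zmodType) (t : tens A B) (f g : A -> B -> V) :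
  (forall a b, f a b = g a b) -> tsum t f = tsum t g.
Proof. by move=> fg; rewrite /tsum /fsum; apply: eq_bigr => p _; apply: fg. Qed.

Lemma tsumDl (V : zmodType) (f : A -> B -> V) x y :
  balanced f -> tsum (x + y) f = tsum x f + tsum y f.
Proof. exact: tsum_add. Qed.

Lemma tsumZl (V : zmodType) (f : A -> B -> V) k x :
  balanced f -> tsum (k *: x) f = tsum x (fun a b => f (k *: a) b).
Proof. exact: tsum_scale. Qed.

Lemma tsumDr (V : zmodType) (f g : A -> B -> V) t :
  tsum t (fun a b => f a b + g a b) = tsum t f + tsum t g.
Proof. exact: big_split. Qed.

Lemma exchange_tsum (A' B' : lmodType K) (V : zmodType) (t : tens A B)
    (u : tens A' B') (f : A -> B -> A' -> B' -> V) :
  \tsum_(a, b <- t) \tsum_(c, d <- u) f a b c d =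
  \tsum_(c, d <- u) \tsum_(a, b <- t) f a b c d.
Proof. exact: exchange_big. Qed.

Lemma additive_tsum (V W : zmodType) (g : {additive V -> W}) (t : tens A B)
    (f : A -> B -> V) :
  g (tsum t f) = tsum t (fun a b => g (f a b)).
Proof. exact: raddf_sum. Qed.

Lemma linear_tsum (V W : lmodType K) (g : {linear V -> W}) (t : tens A B)
    (f : A -> B -> V) :
  g (tsum t f) = tsum t (fun a b => g (f a b)).
Proof. exact: raddf_sum. Qed.

Lemma tsum_mulr (R : pzRingType) (t : tens A B) (f : A -> B -> R) r :
  tsum t f * r = tsum t (fun a b => f a b * r).
Proof. exact: mulr_suml. Qed.

Lemma tsum_mull (R : pzRingType) (t : tens A B) (f : A -> B -> R) r :
  r * tsum t f = tsum t (fun a b => r * f a b).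
Proof. exact: mulr_sumr. Qed.

Lemma tsum_scaler (R : pzRingType) (V : lmodType R) (t : tens A B)
    (f : A -> B -> V) r :
  r *: tsum t f = tsum t (fun a b => r *: f a b).
Proof. exact: scaler_sumr. Qed.

Lemma tsum_scalel (R : pzRingType) (V : lmodType R) (t : tens A B)
    (f : A -> B -> R) (v : V) :
  tsum t f *: v = tsum t (fun a b => f a b *: v).
Proof. exact: scaler_suml. Qed.

Lemma tsum_tsum (A' B' : lmodType K) (V : zmodType) (t : tens A B)
    (F : A -> B -> tens A' B') (f : A' -> B' -> V) : balanced f ->
  tsum (tsum t F) f = \tsum_(a, b <- t) tsum (F a b) f.
Proof.
move=> bf; rewrite {2 3}/tsum /fsum.
elim/big_rec2: _ => [|i y1 y2 _ <-]; first exact: tsum_zero.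
exact: tsum_add.
Qed.

Lemma tsum_tmap (A' B' : lmodType K) (V : zmodType) (g : A -> A') (h : B -> B')
    (t : tens A B) (f : A' -> B' -> V) :
  balanced f -> tsum (tmap g h t) f = \tsum_(a, b <- t) f (g a) (h b).
Proof.
move=> bf; rewrite /tmap tsum_tsum //.
by apply: eq_tsum => a b; rewrite tsum_tens.
Qed.

Lemma tsum_tmul (mA : A -> A -> A) (mB : B -> B -> B) (V : zmodType) x y
    (f : A -> B -> V) : balanced f ->
  tsum (tmul mA mB x y) f =
  \tsum_(a, b <- x) \tsum_(a', b' <- y) f (mA a a') (mB b b').
Proof.
move=> bf; rewrite /tmul tsum_tsum //; apply: eq_tsum => a b.
by rewrite tsum_tsum //; apply: eq_tsum => a' b'; rewrite tsum_tens.
Qed.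

End SweedlerCalculus.

Lemma tsum_tassoc (K : comPzRingType) (A B D : lmodType K) (V : zmodType)
    (x : tens (tens A B) D) (f : A -> tens B D -> V) : balanced f ->
  tsum (tassoc x) f = \tsum_(y, d <- x) \tsum_(a, b <- y) f a (b ⊗ d).
Proof.
move=> bf; rewrite /tassoc tsum_tsum //; apply: eq_tsum => a b.
by rewrite tsum_tsum //; apply: eq_tsum => a' b'; rewrite tsum_tens.
Qed.

Section HopfCalculus.
Variables (C : numClosedFieldType) (H : hopfStarAlg C).
Implicit Types (x y a b : H).

Lemma antipodeVD : {morph @antipodeV C H : x y / x + y}.
Proof.
by move=> x y; apply: (can_inj (@antipodeK C H)); rewrite linearD !antipodeVK.
Qed.

Lemma antipodeVZ k x : antipodeV (k *: x) = k *: antipodeV x.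
Proof.
by apply: (can_inj (@antipodeK C H)); rewrite linearZ /= !antipodeVK.
Qed.

Lemma scaleAl (k : C) x y : (k *: x) * y = k *: (x * y).
Proof. by symmetry; apply: ascaleAl. Qed.

Lemma scaleAr (k : C) x y : x * (k *: y) = k *: (x * y).
Proof. by symmetry; apply: ascaleAr. Qed.

Record balanced3 (V : zmodType) (f : H -> H -> H -> V) : Prop := Balanced3 {
  balanced3_D1 : forall a a' b c, f (a + a') b c = f a b c + f a' b c;
  balanced3_D2 : forall a b b' c, f a (b + b') c = f a b c + f a b' c;
  balanced3_D3 : forall a b c c', f a b (c + c') = f a b c + f a b c';
  balanced3_Z12 : forall k a b c, f (k *: a) b c = f a (k *: b) c;
  balanced3_Z23 : forall k a b c, f a (k *: b) c = f a b (k *: c) }.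

Lemma coassoc3 (V : zmodType) (f : H -> H -> H -> V) x : balanced3 f ->
  \tsum_(u, c <- comul x) \tsum_(a, b <- comul u) f a b c =
  \tsum_(a, u <- comul x) \tsum_(b, c <- comul u) f a b c.
Proof.
move=> [D1 D2 D3 Z12 Z23].
have b23 a : balanced (f a) by split=> *; rewrite ?D2 ?D3 ?Z23.
pose F a (y : tens H H) := tsum y (f a).
have bF : balanced F.
  split=> [a a' y|a y y'|k a y]; rewrite /F.
  - by rewrite -tsumDr; apply: eq_tsum => b c; rewrite D1.
  - by rewrite tsumDl.
  - by rewrite tsumZl //; apply: eq_tsum => b c; rewrite Z12.
have := congr1 (fun t => tsum t F) (coassoc x).
rewrite tsum_tassoc // (tsum_tmap _ _ _ bF) /F => <-.
rewrite tsum_tmap; last first.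
  split=> [y y' c|y c c'|k y c].
  - by rewrite tsumDl //; split=> *;
       rewrite tsum_tens ?tsum_tens // ?D1 ?D2 ?Z12.
  - by rewrite -tsumDr; apply: eq_tsum => a b; rewrite !tsum_tens ?D3.
  - rewrite tsumZl; last by split=> *; rewrite !tsum_tens // ?D1 ?D2 ?Z12.
    by apply: eq_tsum => a b; rewrite !tsum_tens // Z12 Z23.
apply: eq_tsum => u c; apply: eq_tsum => a b.
by rewrite tsum_tens.
Qed.

Lemma comulMl (V : zmodType) (f : H -> H -> V) x y : balanced f ->
  tsum (comul (x * y)) f =
  \tsum_(a, b <- comul x) \tsum_(a', b' <- comul y) f (a * a') (b * b').
Proof. by move=> bf; rewrite comulM tsum_tmul. Qed.

End HopfCalculus.

Ltac tlin := rewrite ?(linearD, antipodeVD, scalerDl, scalerDr, mulrDl, mulrDr);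
  rewrite ?(scalarZ, linearZ, antipodeVZ, scaleAl, scaleAr, scalerA, mulrA) //=.
Ltac tgoal := rewrite /=; first
  [ done
  | rewrite -tsumDr; apply: eq_tsum => ? ?; tgoal
  | apply: eq_tsum => ? ?; tgoal
  | do 6?[progress tlin] ].
Ltac tbal := split=> *; tgoal.


Section Antipode.
Variables (C : numClosedFieldType) (H : hopfStarAlg C).
Implicit Types (x y a b : H).

Lemma antipode1 : antipode (1 : H) = 1.
Proof.
have := antipodel (1 : H); rewrite comul1 tsum_tens; last by tbal.
by rewrite mulr1 counit1 scale1r.
Qed.

Lemma antipodeM x y : antipode (x * y) = antipode y * antipode x.
Proof.
pose F x1 x2 x3 y1 y2 y3 : H :=
  antipode (x1 * y1) * (x2 * y2) * (antipode y3 * antipode x3).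
pose T := \tsum_(x1, u <- comul x) \tsum_(x2, x3 <- comul u)
  \tsum_(y1, v <- comul y) \tsum_(y2, y3 <- comul v) F x1 x2 x3 y1 y2 y3.
have TA : T = antipode (x * y).
  transitivity (\tsum_(x1, u <- comul x) (antipode (counit u *: x1 * y))).
    apply: eq_tsum => x1 u.
    transitivity (\tsum_(x2, x3 <- comul u)
        (antipode (x1 * y) * (x2 * antipode x3))).
      apply: eq_tsum => x2 x3.
      rewrite -[y in RHS]counitr tsum_mull linear_tsum tsum_mulr.
      apply: eq_tsum => y1 v.
      transitivity (antipode (x1 * y1) * x2 *
          (\tsum_(y2, y3 <- comul v) (y2 * antipode y3)) * antipode x3).
        rewrite tsum_mull tsum_mulr; apply: eq_tsum => y2 y3.
        by rewrite /F !mulrA.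
      by rewrite antipoder scaleAr mulr1 scaleAr linearZ /= !scaleAl mulrA.
    rewrite -tsum_mull antipoder scaleAr mulr1 scaleAl linearZ //.
  by rewrite -linear_tsum -tsum_mulr counitr.
have TB : T = antipode y * antipode x.
  transitivity (\tsum_(u, x3 <- comul x) \tsum_(v, y3 <- comul y)
     ((counit (u * v) *: (1 : H)) * (antipode y3 * antipode x3))).
    rewrite /T -coassoc3; last by rewrite /F; tbal.
    apply: eq_tsum => u x3.
    transitivity (\tsum_(x1, x2 <- comul u) \tsum_(v, y3 <- comul y)
        \tsum_(y1, y2 <- comul v) F x1 x2 x3 y1 y2 y3).
      apply: eq_tsum => x1 x2 /=; rewrite coassoc3 //.
      by rewrite /F; tbal.
    rewrite exchange_tsum; apply: eq_tsum => v y3.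
    rewrite -antipodel comulMl; last by tbal.
    by rewrite tsum_mulr; apply: eq_tsum => x1 x2 /=; rewrite tsum_mulr.
  rewrite -[x in RHS]counitl -[y in RHS]counitl.
  rewrite !linear_tsum tsum_mull; apply: eq_tsum => u x3.
  rewrite tsum_mulr; apply: eq_tsum => v y3.
  by rewrite !linearZ /= counitM !scaleAl mul1r scaleAr scalerA mulrC.
exact: etrans (esym TA) TB.
Qed.

Lemma antipodeVM x y : antipodeV (x * y) = antipodeV y * antipodeV x.
Proof.
by apply: (can_inj (@antipodeK C H)); rewrite antipodeM !antipodeVK.
Qed.

Lemma antipodeVr x : \tsum_(a, b <- comul x) (b * antipodeV a) = counit x *: (1 : H).
Proof.
apply: (can_inj (@antipodeK C H)); rewrite linear_tsum linearZ /= antipode1.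
by rewrite -antipoder; apply: eq_tsum => a b /=; rewrite antipodeM antipodeVK.
Qed.

Lemma antipodeV_tsum (B D : lmodType C) (t : tens B D) (f : B -> D -> H) :
  antipodeV (tsum t f) = tsum t (fun p q => antipodeV (f p q)).
Proof.
apply: (can_inj (@antipodeK C H)); rewrite linear_tsum antipodeVK.
by apply: eq_tsum => p q /=; rewrite antipodeVK.
Qed.

Lemma star1 : star (1 : H) = 1.
Proof.
have st y : star (1 : H) * y = y.
  by apply: (can_inj (@starK C H)); rewrite [LHS]amul_star starK; apply: mulr1.
by rewrite -[LHS]mulr1 st.
Qed.

Lemma antipode_starE x : antipode (star x) = star (antipodeV x).
Proof.
apply: (can_inj (@starK C H)); rewrite starK.
by apply: (can_inj (@antipodeK C H)); rewrite antipode_star antipodeVK.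
Qed.

End Antipode.

Section HaarFunctional.
Variables (C : numClosedFieldType) (A : cqg C).
Implicit Types (x y g h k : A).

Lemma haar_strong x g :
  \tsum_(a, b <- comul x) (haar (b * g) *: a) =
  \tsum_(a, b <- comul g) (haar (x * b) *: antipodeV a).
Proof.
transitivity (\tsum_(g1, v <- comul g) \tsum_(g2, g3 <- comul v)
   \tsum_(x1, x2 <- comul x) (haar (x2 * g3) *: (x1 * (g2 * antipodeV g1)))).
  rewrite -coassoc3; last by tbal.
  transitivity (\tsum_(u, g3 <- comul g) \tsum_(x1, x2 <- comul x)
    (haar (x2 * (counit u *: g3)) *: x1)).
    rewrite exchange_tsum; apply: eq_tsum => x1 x2.
    rewrite -{1}[g]counitl tsum_mull additive_tsum tsum_scalel.
    by apply: eq_tsum.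
  apply: eq_tsum => u g3 /=; rewrite exchange_tsum; apply: eq_tsum => x1 x2.
  rewrite -tsum_scaler -tsum_mull antipodeVr.
  by rewrite !scaleAr scalarZ mulr1 scalerA mulrC.
apply: eq_tsum => g1 v.
transitivity ((haar (x * v) *: (1 : A)) * antipodeV g1); last first.
  by rewrite scaleAl mul1r.
rewrite -haar_invl comulMl; last by tbal.
rewrite tsum_mulr exchange_tsum; apply: eq_tsum => x1 x2.
rewrite tsum_mulr; apply: eq_tsum => g2 g3.
by rewrite scaleAl mulrA.
Qed.

Lemma haar_strongl h x :
  \tsum_(a, b <- comul x) (haar (h * b) *: a) =
  \tsum_(a, b <- comul h) (haar (b * x) *: antipode a).
Proof.
transitivity (\tsum_(h1, v <- comul h) \tsum_(h2, h3 <- comul v)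
   \tsum_(x1, x2 <- comul x) (haar (h3 * x2) *: (antipode h1 * (h2 * x1)))).
  rewrite -coassoc3; last by tbal.
  transitivity (\tsum_(u, h3 <- comul h) \tsum_(x1, x2 <- comul x)
    (haar ((counit u *: h3) * x2) *: x1)).
    rewrite exchange_tsum; apply: eq_tsum => x1 x2.
    rewrite -{1}[h]counitl tsum_mulr additive_tsum tsum_scalel.
    by apply: eq_tsum.
  apply: eq_tsum => u h3 /=; rewrite exchange_tsum; apply: eq_tsum => x1 x2.
  transitivity (haar (h3 * x2) *: (\tsum_(h1, h2 <- comul u) 
     (antipode h1 * h2) * x1)).
    by rewrite antipodel !scaleAl scalarZ mul1r scalerA mulrC.
  rewrite tsum_mulr tsum_scaler; apply: eq_tsum => h1 h2.
  by rewrite mulrA.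
apply: eq_tsum => h1 v.
transitivity (antipode h1 * (haar (v * x) *: (1 : A))); last first.
  by rewrite scaleAr mulr1.
rewrite -haar_invl comulMl; last by tbal.
rewrite tsum_mull; apply: eq_tsum => h2 h3.
rewrite tsum_mull; apply: eq_tsum => x1 x2.
by rewrite scaleAr.
Qed.

Lemma haar_strongr x k :
  \tsum_(a, b <- comul x) (haar (a * k) *: b) =
  \tsum_(a, b <- comul k) (haar (x * a) *: antipode b).
Proof.
transitivity (\tsum_(u, k3 <- comul k) \tsum_(k1, k2 <- comul u)
   \tsum_(x1, x2 <- comul x) (haar (x1 * k1) *: (x2 * (k2 * antipode k3)))).
  rewrite coassoc3; last by tbal.
  transitivity (\tsum_(k1, v <- comul k) \tsum_(x1, x2 <- comul x)
    (haar (x1 * (counit v *: k1)) *: x2)).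
    rewrite exchange_tsum; apply: eq_tsum => x1 x2.
    rewrite -{1}[k]counitr tsum_mull additive_tsum tsum_scalel.
    by apply: eq_tsum.
  apply: eq_tsum => k1 v /=; rewrite exchange_tsum; apply: eq_tsum => x1 x2.
  rewrite -tsum_scaler -tsum_mull antipoder.
  by rewrite !scaleAr scalarZ mulr1 scalerA mulrC.
apply: eq_tsum => u k3.
transitivity ((haar (x * u) *: (1 : A)) * antipode k3); last first.
  by rewrite scaleAl mul1r.
rewrite -haar_invr comulMl; last by tbal.
rewrite tsum_mulr exchange_tsum; apply: eq_tsum => x1 x2.
rewrite tsum_mulr; apply: eq_tsum => k1 k2 /=.
by rewrite scaleAl mulrA.
Qed.

Lemma haar_antipodeV x : haar (antipodeV x) = haar x.
Proof.
pose z : A := \tsum_(a, b <- comul x) (haar (antipodeV a) *: b).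
have zE : z = haar x *: (1 : A).
  apply/eqP; rewrite -subr_eq0; apply/eqP/haar_faithfulr => y.
  rewrite mulrBr linearB /=; apply/eqP; rewrite subr_eq0; apply/eqP.
  transitivity (haar (\tsum_(a, b <- comul x) (haar (y * b) *: antipodeV a))).
    rewrite tsum_mull !additive_tsum; apply: eq_tsum => a b /=.
    by rewrite scaleAr !scalarZ mulrC.
  rewrite -haar_strong additive_tsum.
  transitivity (haar ((\tsum_(a, b <- comul y) (haar a *: b)) * x)).
    rewrite tsum_mulr additive_tsum; apply: eq_tsum => a b /=.
    by rewrite scaleAl !scalarZ mulrC.
  by rewrite haar_invr scaleAl mul1r scaleAr mulr1 !scalarZ mulrC.
have := congr1 counit zE.
rewrite scalarZ counit1 mulr1 => <-.
rewrite -[x in LHS]counitr antipodeV_tsum /z !additive_tsum.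
by apply: eq_tsum => a b /=; rewrite antipodeVZ !scalarZ mulrC.
Qed.

Lemma haar_modular h : exists h', forall x, haar (h * x) = haar (x * h').
Proof.
have [c c1] : exists c : A, haar c = 1.
  have [c cN0] := haar_neq0 A.
  by exists ((haar c)^-1 *: c); rewrite scalarZ mulVf.
have key h0 k x :
    \tsum_(h1, h2 <- comul h0) (haar (antipode h1 * k) * haar (h2 * x)) =
    \tsum_(k1, k2 <- comul k) (haar (h0 * antipode k2) * haar (x * k1)).
  transitivity (\tsum_(x1, x2 <- comul x) (haar (x1 * k) * haar (h0 * x2))).
    have := congr1 (fun t => haar (t * k)) (haar_strongl h0 x).
    rewrite !tsum_mulr !additive_tsum => E.
    transitivity (\tsum_(a, b <- comul h0) haar (haar (b * x) *: antipode a * k)).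
      by apply: eq_tsum => a b /=; rewrite scaleAl scalarZ mulrC.
    by rewrite -E; apply: eq_tsum => a b /=; rewrite scaleAl scalarZ mulrC.
  have := congr1 (fun t => haar (h0 * t)) (haar_strongr x k).
  rewrite !tsum_mull !additive_tsum => E.
  transitivity (\tsum_(a, b <- comul x) haar (h0 * (haar (a * k) *: b))).
    by apply: eq_tsum => a b /=; rewrite scaleAr scalarZ.
  by rewrite E; apply: eq_tsum => a b /=; rewrite scaleAr scalarZ mulrC.
exists (\tsum_(h1, u <- comul h) \tsum_(k1, k2 <- comul (antipode (antipode h1) * c))
   (haar (u * antipode k2) *: k1)) => x.
rewrite tsum_mull additive_tsum.
transitivity (\tsum_(h1, u <- comul h) \tsum_(h2, h3 <- comul u)
   (haar (antipode h2 * (antipode (antipode h1) * c)) * haar (h3 * x))).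
  rewrite -coassoc3; last first.
    by tbal; congr (_ * _); apply: mulrC.
  rewrite -{1}[h]counitl tsum_mulr additive_tsum; apply: eq_tsum => w h3.
  transitivity (haar (antipode (\tsum_(a, b <- comul w) (antipode a * b)) * c)
                 * haar (h3 * x)).
    rewrite antipodel linearZ /= antipode1 !scaleAl mul1r !scalarZ c1.
    by rewrite mulr1.
  rewrite linear_tsum tsum_mulr additive_tsum tsum_mulr.
  by apply: eq_tsum => h1 h2 /=; rewrite antipodeM mulrA.
apply: eq_tsum => h1 u /=; rewrite key tsum_mull additive_tsum.
by apply: eq_tsum => k1 k2 /=; rewrite scaleAr scalarZ.
Qed.

Lemma haar_star x : haar (star x) = (haar x)^*.
Proof.
have real (y : A) : haar (y * star y) \is Num.real.
  by rewrite ger0_real ?haar_ge0.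
have pol (a : A) : haar a + haar (star a) \is Num.real.
  have := real (a + 1); rewrite starD star1 mulrDl !mulrDr mulr1 mul1r.
  rewrite !linearD /= => r1.
  have r2 := real a; have r3 := real 1.
  rewrite star1 mul1r in r3.
  rewrite mulr1 in r1.
  have := realB (realB r1 r2) r3.
  by congr (_ \is _); ring.
have /CrealP e1 := pol x; have /CrealP e2 := pol ('i *: x).
move: e2; rewrite starZ !scalarZ conjCi mulNr -mulrBr rmorphM /= conjCi mulNr.
rewrite -mulrN => /(mulfI (neq0Ci C)); rewrite rmorphB /= opprB => e2.
move: e1; rewrite rmorphD /= => e1.
move: (congr2 (fun a b => a - b) e1 e2).
set p := (haar x)^*; set q := (haar (star x))^*.
set r := haar x; set t := haar (star x) => e.
apply: (@mulIf _ 2); first by rewrite pnatr_eq0.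
transitivity (r + t - (r - t)); first by ring.
by rewrite -e; ring.
Qed.

End HaarFunctional.

Section Dual.
Variables (C : numClosedFieldType) (A : cqg C).

(* The functionals h.phi : g |-> phi (g h). *)
Definition in_dual : {pred A -> C^o} :=
  fun w => `[< exists h : A, forall g, w g = haar (g * h) >].

Record dual := Dual { dual_val :> A -> C^o; dual_valP : dual_val \in in_dual }.

HB.instance Definition _ := [isSub for dual_val].
HB.instance Definition _ := [Choice of dual by <:].

Fact in_dual_submod : submod_closed in_dual.
Proof.
split=> [|k u v /asboolP[h hu] /asboolP[h' hv]]; apply/asboolP.
  by exists 0 => g; rewrite mulr0 linear0.
exists (k *: h + h') => g; rewrite mulrDr linearD /= scaleAr linearZ /=.
by rewrite -hu -hv.
Qed.
HB.instance Definition _ :=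
  GRing.isSubmodClosed.Build C (A -> C^o) in_dual in_dual_submod.
HB.instance Definition _ := [SubChoice_isSubLmodule of dual by <:].

Implicit Types (w v : dual) (g h : A).

Lemma dual_ex w : exists h : A, forall g, w g = haar (g * h).
Proof. exact/asboolP/dual_valP. Qed.

Lemma dual_eq w v : (forall g, w g = v g) -> w = v.
Proof. by move=> wv; apply/val_inj/funext. Qed.

Fact dual_mul_subproof w v :
  (fun g => \tsum_(a, b <- comul g) (w a * v b)) \in in_dual.
Proof.
have [h wE] := dual_ex w; have [k vE] := dual_ex v; apply/asboolP.
exists (\tsum_(a, b <- comul k) (haar (antipodeV a * h) *: b)) => g.
transitivity (haar ((\tsum_(a, b <- comul g) (haar (b * k) *: a)) * h)).
  rewrite tsum_mulr additive_tsum; apply: eq_tsum => a b /=.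
  by rewrite wE vE scaleAl scalarZ mulrC.
rewrite haar_strong tsum_mulr tsum_mull !additive_tsum; apply: eq_tsum => a b /=.
by rewrite scaleAl scaleAr !scalarZ mulrC.
Qed.
Definition dual_mul w v : dual := Dual (dual_mul_subproof w v).

Fact dual_antipode_subproof w : (fun g => w (antipode g)) \in in_dual.
Proof.
have [h wE] := dual_ex w; have [h' h'E] := haar_modular (antipodeV h).
apply/asboolP; exists h' => g.
by rewrite wE -haar_antipodeV antipodeVM antipodeK h'E.
Qed.
Definition dual_antipode w : dual := Dual (dual_antipode_subproof w).

Fact dual_antipodeV_subproof w : (fun g => w (antipodeV g)) \in in_dual.
Proof.
have [h wE] := dual_ex w; have [h' h'E] := haar_modular (antipode h).
apply/asboolP; exists h' => g.
by rewrite wE -h'E -[RHS]haar_antipodeV antipodeVM antipodeK.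
Qed.
Definition dual_antipodeV w : dual := Dual (dual_antipodeV_subproof w).

Fact dual_star_subproof w : (fun g => (w (star (antipode g)))^*) \in in_dual.
Proof.
have [h wE] := dual_ex w; apply/asboolP; exists (antipodeV (star h)) => g.
rewrite wE -haar_star [star _]amul_star starK.
by rewrite -[LHS]haar_antipodeV antipodeVM antipodeK.
Qed.
Definition dual_star w : dual := Dual (dual_star_subproof w).

End Dual.

(* A multiplier of (V, mu) is a pair T = (T.1, T.2) of maps, thought of as
   left multiplication x |-> T x and right multiplication x |-> x T. *)

Notation multop V := ((V -> V) * (V -> V))%type.

Section Multipliers.
Variables (C : numClosedFieldType) (V : lmodType C) (mu : V -> V -> V).

Record is_multiplier (T : multop V) : Prop := IsMultiplier {
  mult_linear1 : forall k x y, T.1 (k *: x + y) = k *: T.1 x + T.1 y;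
  mult_linear2 : forall k x y, T.2 (k *: x + y) = k *: T.2 x + T.2 y;
  mult_left : forall x y, T.1 (mu x y) = mu (T.1 x) y;
  mult_right : forall x y, T.2 (mu x y) = mu x (T.2 y);
  mult_compat : forall x y, mu x (T.1 y) = mu (T.2 x) y }.

Definition mult_of (v : V) : multop V := (fun x => mu v x, fun x => mu x v).

Definition mult_one : multop V := (id, id).

Definition mult_mul (T U : multop V) : multop V := (T.1 \o U.1, U.2 \o T.2).

Definition mult_star (st : V -> V) (T : multop V) : multop V :=
  (fun x => st (T.2 (st x)), fun x => st (T.1 (st x))).

End Multipliers.

(* [U] is the value at [T] of the extension to multipliers of the homomorphism
   [f : V -> M(W)], determined by U f(v) = f(T v) and f(v) U = f(v T). *)
Definition mult_extends (C : numClosedFieldType) (V W : lmodType C)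
    (f : V -> multop W) (T : multop V) (U : multop W) : Prop :=
  forall v : V, mult_mul U (f v) = f (T.1 v) /\ mult_mul (f v) U = f (T.2 v).

Definition mult_tens (C : numClosedFieldType) (V W : lmodType C)
    (T : multop V) (U : multop W) : multop (tens V W) :=
  (tmap T.1 U.1, tmap T.2 U.2).

Section DualComultiplication.
Variables (C : numClosedFieldType) (A : cqg C).

(* h_(1) w(h_(2)) = h *)
Definition local_unit (h : A) (w : dual A) : Prop :=
  \tsum_(a, b <- comul h) (w b *: a) = h.

(* The comultiplication of the dual, dual to the product of A: the multiplier
   of dual ⊗ dual whose pairing with g ⊗ h is w(g h).  The pairing is extended
   to multipliers D by evaluating it on D (u ⊗ v) for local units u, v. *)
Definition dual_comul (w : dual A) : multop (tens (dual A) (dual A)) :=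
  xget 0 [set D : multop (tens (dual A) (dual A)) |
    is_multiplier (tmul (@dual_mul C A) (@dual_mul C A)) D /\
    forall (g h : A) (u v : dual A), local_unit g u -> local_unit h v ->
      \tsum_(u', v' <- D.1 (u ⊗ v)) (u' g * v' h) = w (g * h)]%classic.

End DualComultiplication.

Section YetterDrinfeld.
Variables (C : numClosedFieldType) (A : cqg C) (N : starAlgType C).

(* O(G^c) is O(G) with the opposite product; it is represented on the same
   carrier. *)
Definition op_mul (g h : A) : A := h * g.
Definition op_star (h : A) : A := antipodeV (antipodeV (star h)).
Definition op_antipode (h : A) : A := antipodeV h.
Definition op_antipodeV (h : A) : A := antipode h.

Record is_action (theta : {linear N -> tens A N}) : Prop := IsAction {
  theta1 : theta 1 = (1 : A) ⊗ (1 : N);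
  thetaM : forall m n : N,
    theta (m * n) = tmul op_mul amul (theta m) (theta n);
  theta_star : forall m, theta (star m) = tmap op_star star (theta m);
  theta_coassoc : forall m,
    tassoc (tmap comul id (theta m)) = tmap id theta (theta m);
  theta_counit : forall m, \tsum_(a, n <- theta m) (counit a *: n) = m }.

Definition dualN_mul := tmul (@dual_mul C A) (@amul C N).

(* p(h, .) ⊗ id, extended to M(dual ⊗ N) by means of a local unit; the result
   does not depend on its choice. *)
Definition slice (h : A) (T : multop (tens (dual A) N)) : N :=
  \tsum_(w, n <- T.1 (xget 0 [set u | local_unit h u]%classic ⊗ (1 : N)))
    (w h *: n).

Variable thetah : {linear N -> multop (tens (dual A) N)}.

(* the right action m <| h of O(G) on N *)
Definition ract (m : N) (h : A) : N := slice h (thetah m).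

(* dual comultiplication ⊗ id, on dual ⊗ N *)
Definition dual_comul_id (y : tens (dual A) N) :
    multop (tens (tens (dual A) (dual A)) N) :=
  \tsum_(w, n <- y) mult_tens (dual_comul w) (mult_of amul n).

(* id ⊗ thetah, on dual ⊗ N *)
Definition id_thetah (y : tens (dual A) N) :
    multop (tens (dual A) (tens (dual A) N)) :=
  \tsum_(w, n <- y) mult_tens (mult_of (@dual_mul C A) w) (thetah n).

(* In [thetah_coassoc], U and U' are (dual_comul ⊗ id)(thetah m) and
   (id ⊗ thetah)(thetah m).  [thetah_counit] is the counit law, the counit of
   the dual being w |-> w 1. *)
Record is_dual_action : Prop := IsDualAction {
  thetah_mult : forall m, is_multiplier dualN_mul (thetah m);
  thetah1 : thetah 1 = mult_one _;
  thetahM : forall m n, thetah (m * n) = mult_mul (thetah m) (thetah n);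
  thetah_star : forall m,
    thetah (star m) = mult_star (tmap (@dual_star C A) star) (thetah m);
  thetah_coassoc : forall m, exists U U',
    [/\ is_multiplier (tmul (tmul (@dual_mul C A) (@dual_mul C A)) amul) U,
        is_multiplier (tmul (@dual_mul C A) dualN_mul) U',
        mult_extends dual_comul_id (thetah m) U,
        mult_extends id_thetah (thetah m) U' &
        forall x, tassoc (U.1 x) = U'.1 (tassoc x) /\
                  tassoc (U.2 x) = U'.2 (tassoc x)];
  thetah_counit : forall m, ract m 1 = m }.

Variable theta : {linear N -> tens A N}.

Record is_braided_commutative_YD : Prop := IsBraidedCommutativeYD {
  YD_theta : is_action theta;
  YD_thetah : is_dual_action;
  YD_compat : forall m h,
    theta (ract m h) =
    \tsum_(h1, h23 <- comul h) \tsum_(h2, h3 <- comul h23)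
      \tsum_(a, n <- theta m) ((antipodeV h3 * a * h1) ⊗ ract n h2);
  YD_braidl : forall m n, m * n = \tsum_(a, m0 <- theta m) (ract n a * m0);
  YD_braidr : forall m n,
    m * n = \tsum_(a, n0 <- theta n) (n0 * ract m (antipode a)) }.

Definition gamma (m : N) : N := \tsum_(a, m0 <- theta m) ract m0 (antipodeV a).

Definition gammah (m : N) : N :=
  \tsum_(a, m0 <- theta m) ract m0 (antipode (antipode a)).

(* m <|_theta w, for w in the dual *)
Definition dact (m : N) (w : dual A) : N :=
  \tsum_(a, m0 <- theta m) (w a *: m0).

Definition thetah_invariant (f : {scalar N}) : Prop :=
  forall (w : dual A) (m : N),
    \tsum_(v, n <- (thetah m).2 (w ⊗ (1 : N))) (f n *: v) = f m *: w.

End YetterDrinfeld.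

(* Main.v *)
(* The action m <| h is read off the multiplier thetah m by slicing: elements of
   dual ⊗ N are separated by the maps p(h, .) ⊗ id, and functionals of the dual
   that agree with the counit on a large finite set act as local units.  This
   makes N a right module algebra over O(G) and determines thetah by <|.

   With <| available, theta(gamma m) = S^-2(m_(-1)) ⊗ gamma(m_(0)) follows from
   the Yetter-Drinfeld condition, the term m_(-1)(4) S^-1(m_(-1)(3)) cancelling.
   Braided commutativity applied to n gamma(m) then gives
   n gamma(m) = (m_(0) n) <| S^-1(m_(-1)), which yields multiplicativity and,
   under an invariant functional, the twisted trace property; the maps with a
   hat are treated in the same way, with S^2 in place of S^-1. *)

Require Import Defs.
From HB Require Import structures.
From mathcomp Require Import all_boot all_order all_algebra.
From mathcomp Require Import boolp classical_sets functions reals complex.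

Set Implicit Arguments.
Unset Strict Implicit.
Unset Printing Implicit Defensive.
Import Order.TTheory GRing.Theory Num.Theory.
Local Open Scope ring_scope.

(** * Linearity and Sweedler sums *)

(** The comultiplication of the dual is given only by its pairings, as a chosen element of a set, so
    a multiplier with these pairings has to be exhibited and its left part shown to be unique.
    Strong invariance of the Haar functional makes this possible: it moves a functional from the
    coproduct of its argument to the coproduct of its own density, so that convolving any linear
    functional with an element of the dual stays in the dual. Faithfulness makes densities unique
    and lets the dual separate points of [A].

    The counit itself need not lie in the dual. Each computation, however, meets only finitely many
    elements of [A], the legs of chosen representatives, and one element of the dual can agree with
    the counit on all of them; several such requirements are imposed on the same functional. *)

Section LinearCalculus.
Variable K : comPzRingType.
Implicit Types U V W A B D : lmodType K.

Lemma lin_id U : linear (fun x : U => x).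
Proof. by []. Qed.

Lemma lin_app U V W (g : {linear V -> W}) (F : U -> V) :
  linear F -> linear (fun x => g (F x)).
Proof. by move=> lF k x y; rewrite lF linearP. Qed.

Lemma lin_scale U V k (F : U -> V) : linear F -> linear (fun x => k *: F x).
Proof. by move=> lF l x y; rewrite lF scalerDr !scalerA mulrC. Qed.

Lemma lin_scalel U V (v : V) (F : U -> K^o) :
  linear F -> linear (fun x => F x *: v).
Proof. by move=> lF l x y; rewrite lF scalerDl -scalerA. Qed.

Lemma lin_scall U (F : U -> K^o) (c : K) :
  linear F -> linear (fun x => (F x * c : K^o)).
Proof. by move=> lF k x y; rewrite lF mulrDl -mulrA. Qed.

Lemma lin_scalr U (F : U -> K^o) (c : K) :
  linear F -> linear (fun x => (c * F x : K^o)).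
Proof. by move=> lF k x y; rewrite lF mulrDr; congr (_ + _); apply: mulrCA. Qed.

Lemma lin0 U V (F : U -> V) : linear F -> F 0 = 0.
Proof. by move=> lF; have := lF (-1) 0 0; rewrite scaler0 addr0 scaleN1r addNr. Qed.

Lemma linD U V (F : U -> V) x y : linear F -> F (x + y) = F x + F y.
Proof. by move=> lF; have := lF 1 x y; rewrite !scale1r. Qed.

Lemma linZ U V (F : U -> V) k x : linear F -> F (k *: x) = k *: F x.
Proof. by move=> lF; have := lF k x 0; rewrite !addr0 lin0 // addr0. Qed.

(** Linearity in each argument, unlike [balanced], is stable under composition, so it can be derived
    structurally by the tactic [lin] below. *)
Definition bilin A B V (f : A -> B -> V) : Prop :=
  (forall b, linear (fun a => f a b)) /\ (forall a, linear (fun b => f a b)).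

Lemma bilin_balanced A B V (f : A -> B -> V) : bilin f -> balanced f.
Proof.
case=> f1 f2; split=> [a a' b|a b b'|k a b].
- exact: (linD _ _ (f1 b)).
- exact: linD.
- by rewrite (linZ k a (f1 b)) linZ.
Qed.

Lemma bilin_pure A B : bilin (@tpure K A B).
Proof.
split=> [b k x y|a k x y].
  by rewrite balancedDl ?pureZl //; exact: pure_balanced.
rewrite balancedDr; last exact: pure_balanced.
by rewrite -balancedZ ?pureZl //; exact: pure_balanced.
Qed.

Lemma lin_purel U A B (F : U -> A) (b : B) : linear F -> linear (fun x => F x ⊗ b).
Proof. by move=> lF k x y; rewrite lF (bilin_pure A B).1. Qed.

Lemma lin_purer U A B (F : U -> B) (a : A) : linear F -> linear (fun x => a ⊗ F x).
Proof. by move=> lF k x y; rewrite lF (bilin_pure A B).2. Qed.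

Lemma lin_tsum_arg U A B V (F : U -> tens A B) (f : A -> B -> V) :
  linear F -> bilin f -> linear (fun x => tsum (F x) f).
Proof.
move=> lF bf k x y; have bb := bilin_balanced bf.
rewrite lF tsumDl // tsumZl // tsum_scaler; congr (_ + _).
by apply: eq_tsum => a b; rewrite (linZ k a (bf.1 b)).
Qed.

Lemma lin_tsum_fun U A B V (t : tens A B) (f : A -> B -> U -> V) :
  (forall a b, linear (f a b)) -> linear (fun x => tsum t (fun a b => f a b x)).
Proof.
move=> lf k x y; rewrite tsum_scaler -tsumDr.
by apply: eq_tsum => a b; apply: lf.
Qed.

Lemma tsum_pure A B V (f : A -> B -> V) a b : bilin f -> tsum (a ⊗ b) f = f a b.
Proof. by move=> bf; rewrite tsum_tens //; apply: bilin_balanced. Qed.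

Lemma tsum_tsumE A B A' B' V (t : tens A B) (F : A -> B -> tens A' B')
    (f : A' -> B' -> V) : bilin f ->
  tsum (tsum t F) f = \tsum_(a, b <- t) tsum (F a b) f.
Proof. by move=> bf; rewrite tsum_tsum //; apply: bilin_balanced. Qed.

Lemma tsum_tmapE A B A' B' V (g : A -> A') (h : B -> B') (t : tens A B)
    (f : A' -> B' -> V) : bilin f ->
  tsum (tmap g h t) f = \tsum_(a, b <- t) f (g a) (h b).
Proof. by move=> bf; rewrite tsum_tmap //; apply: bilin_balanced. Qed.

Lemma tsum_id A B (t : tens A B) : \tsum_(a, b <- t) (a ⊗ b) = t.
Proof.
apply: tensP => V f bf; rewrite tsum_tsum //.
by apply: eq_tsum => a b; rewrite tsum_tens.
Qed.

Lemma lin_tsum A B V W (g : V -> W) (t : tens A B) (f : A -> B -> V) :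
  linear g -> g (tsum t f) = \tsum_(a, b <- t) g (f a b).
Proof.
move=> lg; rewrite /tsum /fsum; elim: (repr t) => [|p s IH].
  by rewrite !big_nil lin0.
by rewrite !big_cons linD // IH.
Qed.

Lemma tens_lin_eq A B V (F G : tens A B -> V) : linear F -> linear G ->
  (forall a b, F (a ⊗ b) = G (a ⊗ b)) -> F =1 G.
Proof.
by move=> lF lG FG x; rewrite -[x]tsum_id !lin_tsum //; apply: eq_tsum.
Qed.

Lemma tmap_pure A B A' B' (f : A -> A') (g : B -> B') a b :
  linear f -> linear g -> tmap f g (a ⊗ b) = f a ⊗ g b.
Proof.
move=> lf lg; rewrite /tmap tsum_pure //; split=> [?|?].
  exact: lin_purel.
exact: lin_purer.
Qed.

Definition trilin A B D V (f : A -> B -> D -> V) : Prop :=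
  [/\ forall b d, linear (fun a => f a b d), forall a d, linear (fun b => f a b d)
    & forall a b, linear (fun d => f a b d)].

Lemma tassoc_tsum A B D V (x : tens (tens A B) D) (f : A -> B -> D -> V) :
  trilin f ->
  \tsum_(a, z <- tassoc x) \tsum_(b, d <- z) f a b d =
  \tsum_(y, d <- x) \tsum_(a, b <- y) f a b d.
Proof.
case=> f1 f2 f3; rewrite tsum_tassoc.
  apply: eq_tsum => y d; apply: eq_tsum => a b; by rewrite tsum_pure.
apply: bilin_balanced; split=> [z|a].
  by apply: lin_tsum_fun => b d; apply: f1.
exact: lin_tsum_arg.
Qed.

Lemma tassoc_pure A B D (a : A) (b : B) (d : D) :
  tassoc (a ⊗ b ⊗ d) = a ⊗ (b ⊗ d).
Proof.
rewrite /tassoc !tsum_pure //; split=> [?|?].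
- exact: lin_purel.
- by apply: lin_purer; apply: lin_purel.
- apply: lin_tsum_arg => //; split=> [?|?]; first exact: lin_purel.
  by apply: lin_purer; apply: lin_purel.
- by apply: lin_tsum_fun => ? ?; do 2 apply: lin_purer.
Qed.

(** A Sweedler sum runs over one fixed finite representative. An equality that holds only for a
    functional adapted to these finitely many terms is therefore enough. *)
Lemma eq_tsum_in A B V (t : tens A B) (f g : A -> B -> V) :
  (forall p, p \in (repr t : seq (A * B)) -> f p.1 p.2 = g p.1 p.2) -> tsum t f = tsum t g.
Proof. by move=> fg; rewrite /tsum /fsum; apply: eq_big_seq. Qed.

End LinearCalculus.

Lemma lin_scalar (K : comPzRingType) (U V : lmodType K) (g : {scalar V}) (F : U -> V) :
  linear F -> linear (fun x => (g (F x) : K^o)).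
Proof. by move=> lF k x y; rewrite lF linearP. Qed.

Section AlgebraLinear.
Variables (C : numClosedFieldType) (N : starAlgType C) (U : lmodType C).

Lemma lin_mull (c : N) (F : U -> N) : linear F -> linear (fun x => c * F x).
Proof. by move=> lF k x y; rewrite lF mulrDr; congr (_ + _); symmetry; apply: ascaleAr. Qed.

Lemma lin_mulr (c : N) (F : U -> N) : linear F -> linear (fun x => F x * c).
Proof. by move=> lF k x y; rewrite lF mulrDl; congr (_ + _); symmetry; apply: ascaleAl. Qed.

Lemma amul_scaleAl k (m n : N) : (k *: m) * n = k *: (m * n).
Proof. exact/esym/ascaleAl. Qed.

Lemma amul_scaleAr k (m n : N) : m * (k *: n) = k *: (m * n).
Proof. exact/esym/ascaleAr. Qed.

End AlgebraLinear.

Lemma lin_antipodeV (C : numClosedFieldType) (H : hopfStarAlg C) (U : lmodType C)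
    (F : U -> H) : linear F -> linear (fun x => antipodeV (F x)).
Proof. by move=> lF k x y; rewrite lF antipodeVD antipodeVZ. Qed.

Lemma lin_comp (K : comPzRingType) (U V W : lmodType K) (g : V -> W) (F : U -> V) :
  linear g -> linear F -> linear (fun x => g (F x)).
Proof. by move=> lg lF k x y; rewrite lF lg. Qed.

Ltac lin_hyp := match goal with
  | b : bilin _ |- _ => first [apply: (lin_comp (b.1 _)) | apply: (lin_comp (b.2 _))]
  | b : trilin _ |- _ => let h1 := fresh in let h2 := fresh in let h3 := fresh in
     case: (b) => h1 h2 h3;
     first [apply: (lin_comp (h1 _ _)) | apply: (lin_comp (h2 _ _))
           | apply: (lin_comp (h3 _ _))]
  | l : linear _ |- _ => apply: (lin_comp l)
  | l : forall _, linear _ |- _ => apply: (lin_comp (l _))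
  | l : forall _ _, linear _ |- _ => apply: (lin_comp (l _ _))
  end.

(* [lin] proves linearity by descending along the only path to the variable.
   In the patterns below, [type of a] fails exactly when [a] mentions it.
   [lin_extra] is extended as further operations appear. *)
Ltac lin_extra := fail.

Ltac lin_step := first
  [ match goal with
    | |- _ (fun x => x) => exact: lin_id
    | |- _ (fun x => tpure ?a _) => let T := type of a in apply: lin_purer
    | |- _ (fun x => tpure _ _) => apply: lin_purel
    | |- _ (fun x => antipodeV _) => apply: lin_antipodeV
    | |- _ (fun x => tsum ?t _) => let T := type of t in apply: lin_tsum_fun
    | |- _ (fun x => tsum _ _) => apply: lin_tsum_arg
    | |- _ (fun x => GRing.mul ?a _) =>
        let T := type of a in first [apply: lin_mull | apply: lin_scalr]
    | |- _ (fun x => GRing.mul _ _) => first [apply: lin_mulr | apply: lin_scall]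
    | |- _ (fun x => GRing.scale ?a _) => let T := type of a in apply: lin_scale
    | |- _ (fun x => GRing.scale _ _) => apply: lin_scalel
    end
  | lin_extra
  | apply: lin_scalar | apply: lin_app | lin_hyp | assumption ].

Ltac lin := intros; lazymatch goal with
  | |- bilin _ => split; lin
  | |- trilin _ => split; lin
  | |- GRing.linear_for ?s ?f =>
      change (GRing.linear_for s (fun x => f x)); cbv beta; lin_step; lin
  | _ => assumption
  end.

(** * Hopf algebra identities for the antipode and its inverse *)

Section HopfStructure.
Variables (C : numClosedFieldType) (H : hopfStarAlg C).
Implicit Types x y a b : H.

Lemma coassocE (V : lmodType C) (f : H -> H -> H -> V) x : trilin f ->
  \tsum_(u, c <- comul x) \tsum_(a, b <- comul u) f a b c =
  \tsum_(a, u <- comul x) \tsum_(b, c <- comul u) f a b c.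
Proof.
case=> f1 f2 f3; apply: coassoc3; split=> *.
- exact: (linD _ _ (f1 _ _)).
- exact: (linD _ _ (f2 _ _)).
- exact: (linD _ _ (f3 _ _)).
- by rewrite (linZ _ _ (f1 _ _)) (linZ _ _ (f2 _ _)).
- by rewrite (linZ _ _ (f2 _ _)) (linZ _ _ (f3 _ _)).
Qed.

Lemma comulME (V : lmodType C) (f : H -> H -> V) x y : bilin f ->
  tsum (comul (x * y)) f =
  \tsum_(a, b <- comul x) \tsum_(a', b' <- comul y) f (a * a') (b * b').
Proof. by move=> bf; rewrite comulMl //; apply: bilin_balanced. Qed.

Lemma counitlE (V : lmodType C) (f : H -> V) x : linear f ->
  \tsum_(a, b <- comul x) (counit a *: f b) = f x.
Proof.
move=> lf; rewrite -[x in RHS]counitl lin_tsum //.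
by apply: eq_tsum => a b; rewrite linZ.
Qed.

Lemma counitrE (V : lmodType C) (f : H -> V) x : linear f ->
  \tsum_(a, b <- comul x) (counit b *: f a) = f x.
Proof.
move=> lf; rewrite -[x in RHS]counitr lin_tsum //.
by apply: eq_tsum => a b; rewrite linZ.
Qed.

Lemma counit_antipode x : counit (antipode x) = counit x.
Proof.
have /(congr1 counit) := antipodel x; rewrite scalarZ counit1 mulr1 => <-.
rewrite -[x in LHS]counitr linear_tsum !additive_tsum; apply: eq_tsum => a b /=.
by rewrite linearZ scalarZ counitM mulrC.
Qed.

Lemma counit_antipodeV x : counit (antipodeV x) = counit x.
Proof. by rewrite -counit_antipode antipodeVK. Qed.

Lemma antipodeVl x : \tsum_(a, b <- comul x) (antipodeV b * a) = counit x *: (1 : H).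
Proof.
apply: (can_inj (@antipodeK C H)); rewrite linear_tsum linearZ /= antipode1.
by rewrite -antipodel; apply: eq_tsum => a b /=; rewrite antipodeM antipodeVK.
Qed.

(* Both sides are convolution inverses of comul, as for [antipodeM]. *)
Lemma comul_antipode x :
  comul (antipode x) = \tsum_(a, b <- comul x) (antipode b ⊗ antipode a).
Proof.
pose E (x1 x2 : H) (p q : H) : tens H H :=
  \tsum_(a, b <- comul (antipode x1 * x2)) ((a * p) ⊗ (b * q)).
(* The triple convolution of comul∘S, comul and the candidate x |-> S(x_(2)) ⊗ S(x_(1)). Collapsing
   its last two factors leaves the left-hand side, collapsing its first two the right-hand side. *)
pose T := \tsum_(x1, u <- comul x) \tsum_(x2, v <- comul u)
   \tsum_(x3, x4 <- comul v) E x1 x2 (antipode x4) (antipode x3).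
transitivity T.
  rewrite -[LHS](counitrE (f := fun x => comul (antipode x))); last by lin.
  apply: eq_tsum => x1 u; rewrite /E.
  rewrite -[comul (antipode x1)]tsum_id tsum_scaler.
  transitivity (\tsum_(a, b <- comul (antipode x1)) \tsum_(x2, v <- comul u)
     \tsum_(x3, x4 <- comul v) \tsum_(c, d <- comul x2)
     ((a * (c * antipode x4)) ⊗ (b * (d * antipode x3)))); last first.
    rewrite exchange_tsum; apply: eq_tsum => x2 v.
    rewrite exchange_tsum; apply: eq_tsum => x3 x4 /=.
    rewrite comulME; last by lin.
    by apply: eq_tsum => a b; apply: eq_tsum => c d; rewrite !mulrA.
  apply: eq_tsum => a b.
  rewrite -coassocE; last by lin.
  transitivity (\tsum_(w, x4 <- comul u) ((a * (w * antipode x4)) ⊗ b)).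
    rewrite -(lin_tsum (g := fun y => (a * y) ⊗ b)); last by lin.
    rewrite antipoder (linZ (F := fun y => (a * y) ⊗ b)); last by lin.
    by rewrite mulr1.
  apply: eq_tsum => w x4; rewrite coassocE; last by lin.
  rewrite -[LHS](counitrE (f := fun c => (a * (c * antipode x4)) ⊗ b)); last by lin.
  apply: eq_tsum => c z.
  rewrite -(lin_tsum (g := fun y => (a * (c * antipode x4)) ⊗ (b * y))); last by lin.
  rewrite antipoder (linZ (F := fun y => _ ⊗ (b * y))); last by lin.
  by rewrite mulr1.
(* This is comul(y) (S(x4) ⊗ S(x3)), linear in [y], so that S(x1) x2 can be summed to a counit
   inside it. *)
pose g y v : tens H H := \tsum_(x3, x4 <- comul v) \tsum_(a, b <- comul y)
  ((a * antipode x4) ⊗ (b * antipode x3)).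
have lg v : linear (fun y => g y v) by rewrite /g; lin.
transitivity (\tsum_(w, v <- comul x) \tsum_(x1, x2 <- comul w) g (antipode x1 * x2) v).
  by rewrite coassocE // /g; lin.
transitivity (\tsum_(w, v <- comul x) (counit w *: g 1 v)).
  apply: eq_tsum => w v.
  by rewrite -(lin_tsum (g := fun y => g y v)) // antipodel (linZ _ _ (lg v)).
rewrite counitlE; last by rewrite /g; lin.
apply: eq_tsum => x3 x4; rewrite comul1 tsum_pure; last by lin.
by rewrite !mul1r.
Qed.

Lemma comul_antipodeE (V : lmodType C) (f : H -> H -> V) x : bilin f ->
  tsum (comul (antipode x)) f = \tsum_(a, b <- comul x) f (antipode b) (antipode a).
Proof.
move=> bf; rewrite comul_antipode tsum_tsumE //.
by apply: eq_tsum => a b; rewrite tsum_pure.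
Qed.

Lemma comul_antipodeVE (V : lmodType C) (f : H -> H -> V) x : bilin f ->
  tsum (comul (antipodeV x)) f = \tsum_(a, b <- comul x) f (antipodeV b) (antipodeV a).
Proof.
move=> bf; rewrite -[x in RHS]antipodeVK comul_antipodeE.
  by apply: eq_tsum => a b; rewrite !antipodeK.
by lin.
Qed.

End HopfStructure.

(** * The dual and evaluation of tensors *)

(* Otherwise [/=] turns [(k *: w + v) g] into an operation on bare functions. *)
Arguments dual_val {C A} _ _ : simpl never.

Section DualFacts.
Variables (C : numClosedFieldType) (A : cqg C).
Implicit Types (w v u : dual A) (g h : A).

Lemma dualP k w v g : (k *: w + v) g = k * w g + v g.
Proof. by have /(congr1 (fun f => f g)) := linearP (val : dual A -> _) k w v. Qed.

Lemma dual_linear w : linear (fun g => (w g : C^o)).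
Proof.
have [h wE] := dual_ex w => k x y.
by rewrite !wE mulrDl scaleAl linearP.
Qed.

Lemma lin_dual (U : lmodType C) w (F : U -> A) :
  linear F -> linear (fun x => (w (F x) : C^o)).
Proof. exact: lin_comp (dual_linear w). Qed.

Lemma lin_dual_fun (U : lmodType C) (F : U -> dual A) g :
  linear F -> linear (fun x => (F x g : C^o)).
Proof. by move=> lF k x y; rewrite lF dualP. Qed.

Lemma dual_mulE w v g : dual_mul w v g = \tsum_(a, b <- comul g) (w a * v b).
Proof. by []. Qed.

Lemma dual_mul_bilin : bilin (@dual_mul C A).
Proof.
split=> [v k w w'|w k v v']; apply: dual_eq => g; rewrite dualP !dual_mulE.
  rewrite tsum_mull -tsumDr; apply: eq_tsum => a b.
  by rewrite dualP mulrDl mulrA.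
rewrite tsum_mull -tsumDr; apply: eq_tsum => a b.
by rewrite dualP mulrDr mulrCA.
Qed.

Lemma lin_dual_mull (U : lmodType C) w (F : U -> dual A) :
  linear F -> linear (fun x => dual_mul w (F x)).
Proof. exact: lin_comp (dual_mul_bilin.2 w). Qed.

Lemma lin_dual_mulr (U : lmodType C) w (F : U -> dual A) :
  linear F -> linear (fun x => dual_mul (F x) w).
Proof. exact: lin_comp (dual_mul_bilin.1 w). Qed.

Definition haar_dual (k : A) : dual A :=
  Dual (asboolT (ex_intro _ k (fun g => erefl (haar (g * k))))).

Lemma haar_dualE k g : haar_dual k g = haar (g * k).
Proof. by []. Qed.

Lemma haar_dual_linear : linear haar_dual.
Proof.
move=> k x y; apply: dual_eq => g.
by rewrite dualP !haar_dualE mulrDr scaleAr linearP.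
Qed.

Lemma haar_dual_inj : injective haar_dual.
Proof.
move=> k k' e; apply/eqP; rewrite -subr_eq0; apply/eqP/haar_faithfulr => y.
have /(congr1 (fun w : dual A => w y)) := e; rewrite !haar_dualE.
by rewrite mulrBr linearB => ->; rewrite subrr.
Qed.

Lemma haar_dual_surj w : exists k, haar_dual k = w.
Proof. by have [k wE] := dual_ex w; exists k; apply: dual_eq => g; rewrite wE. Qed.

(** The inverse of [haar_dual]: existence is the definition of the dual, and faithfulness gives the
    uniqueness from which linearity follows. *)
Definition density w : A := projT1 (cid (haar_dual_surj w)).

Lemma densityK : cancel density haar_dual.
Proof. by move=> w; rewrite /density; case: cid. Qed.

Lemma density_linear : linear density.
Proof.
by move=> k w v; apply: haar_dual_inj; rewrite haar_dual_linear !densityK.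
Qed.

Lemma dual_density w g : w g = haar (g * density w).
Proof. by rewrite -[w in LHS]densityK. Qed.

(** This is faithfulness in the other argument of haar(x y) than the one used for
    [haar_dual_inj]. *)
Lemma dual_sep g g' : (forall w, w g = w g') -> g = g'.
Proof.
move=> e; apply/eqP; rewrite -subr_eq0; apply/eqP/haar_faithfull => y.
by rewrite mulrBl linearB /=; apply/eqP; rewrite subr_eq0; apply/eqP/(e (haar_dual y)).
Qed.

(* p(h, .) ⊗ id *)
Definition eval_l (V : lmodType C) h (x : tens (dual A) V) : V :=
  \tsum_(w, n <- x) (w h *: n).

End DualFacts.

Ltac lin_extra ::= first
  [ apply: lin_dual_fun | apply: lin_dual | apply: lin_dual_mull | apply: lin_dual_mulr ].

Section Evaluation.
Variables (C : numClosedFieldType) (A : cqg C) (V : lmodType C).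
Implicit Types (w v u : dual A) (g h : A) (x y : tens (dual A) V).

Lemma eval_l_bilin : bilin (@eval_l C A V).
Proof. rewrite /eval_l; lin. Qed.

Lemma lin_eval_l (U : lmodType C) h (F : U -> tens (dual A) V) :
  linear F -> linear (fun z => eval_l h (F z)).
Proof. exact: lin_comp (eval_l_bilin.2 h). Qed.

Lemma lin_eval_arg (U : lmodType C) (F : U -> A) x :
  linear F -> linear (fun z => eval_l (F z) x).
Proof. exact: lin_comp (eval_l_bilin.1 x). Qed.

Lemma eval_l_pure h w (n : V) : eval_l h (w ⊗ n) = w h *: n.
Proof. by rewrite /eval_l tsum_pure //; lin. Qed.

(* Induction on the number of terms: if w h0 != 0 for the first term w ⊗ m,
   then m is a combination of the other second factors. *)
Lemma eval_l_inj0 x : (forall h, eval_l h x = 0) -> x = 0.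
Proof.
rewrite -[x]tsum_id /tsum /fsum => H.
have {H} : forall h, \sum_(p <- (repr x : seq (_ * V))) ((p.1 : dual A) h *: p.2) = 0.
  move=> h; apply: etrans (H h).
  elim: (repr x : seq _) => [|p s IH]; first by rewrite !big_nil lin0 //; exact: eval_l_bilin.2.
  by rewrite !big_cons (linD _ _ (eval_l_bilin.2 h)) eval_l_pure IH.
move: (repr x : seq (dual A * V)) => s {x}.
have [n] := ubnP (size s); elim: n s => // n IH [|[w m] s] /=; first by rewrite big_nil.
rewrite ltnS => sn; rewrite big_cons /= => H.
have [w0|/existsNP[h0 wN0]] := pselect (forall h, w h = 0).
  have -> : w = 0.
    by apply: dual_eq => h; rewrite w0 -[0 in RHS](subrr w) -scaleN1r addrC dualP mulN1r addNr.
  rewrite (lin0 (F := fun w => w ⊗ m)) ?add0r; last by lin.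
  by apply: IH => // h; have := H h; rewrite big_cons w0 scale0r add0r.
pose c (p : dual A * V) := p.1 h0 / w h0.
have mE : m = - \sum_(p <- s) (c p *: p.2).
  have := H h0; rewrite big_cons => /(congr1 (fun z => (w h0)^-1 *: z)).
  rewrite /= scalerDr scalerA mulVf ?scale1r; last exact/eqP.
  rewrite scaler0 => /eqP; rewrite addr_eq0 => /eqP ->; rewrite scaler_sumr.
  by congr (- _); apply: eq_bigr => p _; rewrite scalerA mulrC.
(* Substituting for [m] moves [w] into the other first factors: each term p of [s] becomes (p.1 -
   c(p) w) ⊗ p.2, and the list is shorter by one. *)
pose s' := [seq (- c p *: w + p.1, p.2) | p <- s].
have -> : w ⊗ m + \sum_(p <- s) (p.1 ⊗ p.2) = \sum_(p <- s') (p.1 ⊗ p.2).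
  rewrite mE big_map /=.
  elim: {IH sn H mE s'} s => [|p s IHs].
    rewrite !big_nil oppr0 addr0; exact: (lin0 ((bilin_pure _ _).2 w)).
  rewrite !big_cons -IHs (bilin_pure _ _).1 opprD -scaleNr.
  rewrite (bilin_pure _ _).2.
  by rewrite addrACA.
apply: IH; rewrite ?size_map // => h.
rewrite big_map /=; apply: etrans (H h); rewrite big_cons /= {1}mE.
rewrite scalerN scaler_sumr -sumrN -big_split; apply: eq_bigr => p _ /=.
by rewrite dualP scalerDl scalerA mulNr scaleNr mulrC.
Qed.

Lemma eval_l_inj x y : (forall h, eval_l h x = eval_l h y) -> x = y.
Proof.
move=> e; apply/eqP; rewrite -subr_eq0; apply/eqP/eval_l_inj0 => h.
by rewrite addrC -scaleN1r (eval_l_bilin.2 h) e scaleN1r addNr.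
Qed.

End Evaluation.

(** * Local units and slices of multipliers *)

Section LocalUnits.
Variables (C : numClosedFieldType) (A : cqg C).
Implicit Types (w v u : dual A) (g h : A).

(** The second alternative expresses that [b] lies in the span of [s]. In the induction, if some [v]
    vanishes on [s] but not at [c], then [b] is corrected by a multiple of [c] to a [b'] with v(b')
    = 0. *)
Lemma dual_separation (s : seq A) (b : A) :
  (exists2 v : dual A, forall x, x \in s -> v x = 0 & v b != 0) \/
  (forall f : A -> C^o, linear f -> (forall x, x \in s -> f x = 0) -> f b = 0).
Proof.
elim: s b => [|c s IH] b.
  have [->|bN0] := eqVneq b 0; first by right=> f lf _; rewrite lin0.
  left; apply: contrapT => H; case/eqP: bN0; apply: dual_sep => w.
  rewrite (lin0 (dual_linear w)); apply: contrapT => /eqP wb.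
  by apply: H; exists w.
have [[v vs vc]|sc] := IH c; last first.
  have [[v vs vb]|sb] := IH b.
    left; exists v => // x; rewrite inE => /orP[/eqP->|/vs//].
    exact: sc (dual_linear v) vs.
  by right=> f lf fs; apply: sb => // x xs; apply: fs; rewrite inE xs orbT.
pose b' := - (v b / v c) *: c + b.
have [[w ws wb]|sb] := IH b'; last first.
  right=> f lf fs; have := sb f lf; rewrite /b' lf fs ?mem_head // scaler0 add0r.
  by apply=> x xs; apply: fs; rewrite inE xs orbT.
(* The multiple of [v] makes the functional vanish at [c], and its value at [b] is then exactly
   w(b'). *)
left; exists (- (w c / v c) *: v + w) => [x|].
  rewrite dualP inE => /orP[/eqP->|xs]; last by rewrite (vs x xs) (ws x xs) mulr0 addr0.
  by rewrite mulNr mulfVK // addNr.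
rewrite dualP; apply: contraNneq wb => e; apply/eqP.
rewrite /b' (dual_linear w) -[RHS]e; congr (_ + _).
by rewrite !mulNr /GRing.scale /= mulNr mulrAC [in RHS]mulrAC; congr (- (_ / _)); apply: mulrC.
Qed.

(** If the new point is separated from the earlier ones, a multiple of [v] corrects the value there.
    Otherwise [f - u], which vanishes at the earlier points, vanishes at the new one as well. *)
Lemma dual_interpolation (f : A -> C^o) (s : seq A) : linear f ->
  exists u : dual A, forall x, x \in s -> u x = f x.
Proof.
move=> lf; elim: s => [|b s [u us]]; first by exists (haar_dual 0).
have [[v vs vb]|sb] := dual_separation s b.
  exists (((f b - u b) / v b) *: v + u) => x.
  rewrite dualP inE => /orP[/eqP->|xs]; first by rewrite mulfVK // subrK.
  by rewrite (vs x xs) (us x xs) mulr0 add0r.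
exists u => x; rewrite inE => /orP[/eqP->|/us//].
apply/eqP; rewrite eq_sym -subr_eq0; apply/eqP.
apply: (sb (fun y => f y - u y)) => [|y ys]; last by rewrite us // subrr.
move=> k y z; rewrite lf (dual_linear u) scalerBr.
by rewrite opprD addrACA.
Qed.

(* The sets of functionals agreeing with the counit on a given finite set form a
   filter basis, along which [P] is required to hold. *)
Definition near_counit (P : dual A -> Prop) : Prop :=
  exists s : seq A, forall u, (forall x, x \in s -> u x = counit x) -> P u.

Lemma near_counit_ex (P : dual A -> Prop) : near_counit P -> exists u, P u.
Proof.
case=> s sP; have [|u us] := @dual_interpolation counit s.
  by move=> k x y; rewrite linearP.
by exists u; apply: sP.
Qed.

Lemma near_counit_and (P Q : dual A -> Prop) :
  near_counit P -> near_counit Q -> near_counit (fun u => P u /\ Q u).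
Proof.
move=> [s sP] [t tQ]; exists (s ++ t) => u ust.
by split; [apply: sP|apply: tQ] => x xs; apply: ust; rewrite mem_cat xs ?orbT.
Qed.

Lemma near_counit_all (T : eqType) (s : seq T) (P : T -> dual A -> Prop) :
  (forall x, x \in s -> near_counit (P x)) ->
  near_counit (fun u => forall x, x \in s -> P x u).
Proof.
elim: s => [|y s IH] H; first by exists [::].
have [|t tP] := near_counit_and (H y (mem_head _ _)) (IH _).
  by move=> x xs; apply: H; rewrite inE xs orbT.
by exists t => u /tP[Py Ps] x; rewrite inE => /orP[/eqP->|/Ps].
Qed.

Lemma near_local_unit h : near_counit (local_unit h).
Proof.
exists [seq p.2 | p <- (repr (comul h) : seq (A * A))] => u us.
rewrite /local_unit -[RHS]counitr; apply: eq_tsum_in => p ps.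
by rewrite us //; apply: map_f.
Qed.

(* By strong invariance, (u w)(g) = u(S^-1 k1) haar(g k2) for w = haar(. k). *)
Lemma near_dual_mul w : near_counit (fun u => dual_mul u w = w).
Proof.
exists [seq antipodeV p.1 | p <- (repr (comul (density w)) : seq (A * A))] => u us.
apply: dual_eq => g; rewrite dual_mulE.
transitivity (u (\tsum_(a, b <- comul g) (haar (b * density w) *: a))).
  rewrite (lin_tsum _ _ (dual_linear u)); apply: eq_tsum => a b.
  by rewrite (linZ _ _ (dual_linear u)) [w b]dual_density; apply: mulrC.
rewrite haar_strong (lin_tsum _ _ (dual_linear u)) dual_density.
transitivity (\tsum_(a, b <- comul (density w)) (counit a * haar (g * b))).
  apply: eq_tsum_in => p ps; rewrite (linZ _ _ (dual_linear u)) us; last exact: (map_f (fun p : A * A => antipodeV p.1) ps).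
  by rewrite counit_antipodeV; apply: mulrC.
rewrite -{2}[density w]counitl tsum_mull additive_tsum; apply: eq_tsum => a b.
by rewrite /= scaleAr scalarZ.
Qed.

Lemma local_unit_tsum (V : lmodType C) h u (f : A -> V) : local_unit h u -> linear f ->
  \tsum_(a, b <- comul h) (u b *: f a) = f h.
Proof.
move=> hu lf; rewrite -[in RHS]hu lin_tsum //.
by apply: eq_tsum => a b; rewrite linZ.
Qed.

End LocalUnits.

Section Slices.
Variables (C : numClosedFieldType) (A : cqg C) (N : starAlgType C).
Implicit Types (w v u : dual A) (g h : A) (n m : N) (x y : tens (dual A) N).
Implicit Types (T U : multop (tens (dual A) N)).
Local Notation mulDN := (@dualN_mul C A N).

Lemma tmul_pure (A1 A2 : lmodType C) (mA : A1 -> A1 -> A1) (mB : A2 -> A2 -> A2) a b a' b' :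
  bilin mA -> bilin mB -> tmul mA mB (a ⊗ b) (a' ⊗ b') = mA a a' ⊗ mB b b'.
Proof.
move=> bA bB; rewrite /tmul !tsum_pure //; lin.
Qed.

Lemma tmul_bilin (A1 A2 : lmodType C) (mA : A1 -> A1 -> A1) (mB : A2 -> A2 -> A2) :
  bilin mA -> bilin mB -> bilin (tmul mA mB).
Proof. move=> bA bB; rewrite /tmul; lin. Qed.

Lemma amul_bilin : bilin (@amul C N).
Proof.
by split=> [b|a]; [exact: (@lin_mulr _ N _ b id)|exact: (@lin_mull _ N _ a id)].
Qed.

Lemma dualN_mul_bilin : bilin mulDN.
Proof. exact: tmul_bilin (dual_mul_bilin A) amul_bilin. Qed.

Lemma dualN_mul_pure w v m n : mulDN (w ⊗ m) (v ⊗ n) = dual_mul w v ⊗ (m * n).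
Proof. exact: tmul_pure (dual_mul_bilin A) amul_bilin. Qed.

Lemma eval_l_mul h x y :
  eval_l h (mulDN x y) = \tsum_(a, b <- comul h) (eval_l a x * eval_l b y).
Proof.
move: y; apply: tens_lin_eq => [||v n].
- apply: lin_eval_l; exact: dualN_mul_bilin.2.
- by apply: lin_tsum_fun => a b; apply: lin_mull; apply: lin_eval_l.
move: x; apply: tens_lin_eq => [||w m].
- apply: lin_eval_l; exact: dualN_mul_bilin.1.
- by apply: lin_tsum_fun => a b; apply: lin_mulr; apply: lin_eval_l.
rewrite dualN_mul_pure eval_l_pure dual_mulE tsum_scalel.
apply: eq_tsum => a b; rewrite !eval_l_pure [_ * (v b *: n)]amul_scaleAr.
by rewrite [(w a *: m) * n]amul_scaleAl scalerA mulrC.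
Qed.

(** A functional [v] close to the counit absorbs both [u] and the chosen [u0]. For either of them,
    T(w ⊗ 1) = T(v ⊗ 1)(w ⊗ 1), and evaluation at [h] removes the local unit [w], leaving the same
    value. *)
Lemma slice_unit h T u : is_multiplier mulDN T -> local_unit h u ->
  slice h T = eval_l h (T.1 (u ⊗ (1 : N))).
Proof.
move=> mT hu.
pose u0 := xget 0 [set u | local_unit h u]%classic.
have hu0 : local_unit h u0 by apply: (@xgetPex _ 0 [set u | local_unit h u]%classic); exists u.
have [v [vu vu0]] := near_counit_ex (near_counit_and (near_dual_mul u) (near_dual_mul u0)).
have key w : dual_mul v w = w -> local_unit h w ->
    eval_l h (T.1 (w ⊗ (1 : N))) = eval_l h (T.1 (v ⊗ (1 : N))).
  move=> vw hw; rewrite -{1}vw -{1}[(1 : N)]mulr1 -dualN_mul_pure (mult_left mT) eval_l_mul.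
  rewrite -[RHS](local_unit_tsum (f := fun g => eval_l g _) hw).
    by apply: eq_tsum => a b; rewrite eval_l_pure amul_scaleAr mulr1.
  exact: (eval_l_bilin _ _).1.
by rewrite key // -(key u0).
Qed.

(** The local unit chosen in [slice] varies with [h]; replacing it by one that serves all three
    elements leaves evaluation at a fixed tensor. *)
Lemma slice_linear T : is_multiplier mulDN T -> linear (fun h => slice h T).
Proof.
move=> mT k g h; have [u [[ug uh] ugh]] := near_counit_ex (near_counit_and
   (near_counit_and (near_local_unit g) (near_local_unit h)) (near_local_unit (k *: g + h))).
by rewrite !(slice_unit mT (u := u)) // (eval_l_bilin _ _).1.
Qed.

(** With its mirror image below, this shows that a multiplier is determined by its slices. The proof
    writes x as (u ⊗ 1) x, with [u] a local unit for every left leg of [h]. *)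
Lemma eval_mult1 h T x : is_multiplier mulDN T ->
  eval_l h (T.1 x) = \tsum_(a, b <- comul h) (slice a T * eval_l b x).
Proof.
move=> mT; move: x; apply: tens_lin_eq => [||w n].
- by apply: lin_eval_l; exact: mult_linear1 mT.
- by apply: lin_tsum_fun => a b; apply: lin_mull; apply: lin_eval_l.
have [u [uw uh]] := near_counit_ex (near_counit_and (near_dual_mul w)
  (near_counit_all (s := repr (comul h)) (fun p _ => near_local_unit p.1))).
rewrite -{1}uw -{1}[n]mul1r -dualN_mul_pure (mult_left mT) eval_l_mul.
by apply: eq_tsum_in => p ps; rewrite -slice_unit //; apply: uh.
Qed.

(** Slices are defined by left multiplication, so the right part is reached through the
    compatibility T.2(x) (u ⊗ 1) = x T.1(u ⊗ 1). *)
Lemma eval_mult2 h T x : is_multiplier mulDN T ->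
  eval_l h (T.2 x) = \tsum_(a, b <- comul h) (eval_l a x * slice b T).
Proof.
move=> mT.
have [u [hu uh]] := near_counit_ex (near_counit_and (near_local_unit h)
  (near_counit_all (s := repr (comul h)) (fun p _ => near_local_unit p.2))).
transitivity (eval_l h (mulDN (T.2 x) (u ⊗ (1 : N)))).
  rewrite eval_l_mul -[LHS](local_unit_tsum (f := fun g => eval_l g _) hu).
    by apply: eq_tsum => a b; rewrite eval_l_pure amul_scaleAr mulr1.
  exact: (eval_l_bilin _ _).1.
rewrite -(mult_compat mT) eval_l_mul.
by apply: eq_tsum_in => p ps; rewrite -slice_unit //; apply: uh.
Qed.

End Slices.

(** * The comultiplication of the dual *)

Section DualComultiplicationFacts.
Variables (C : numClosedFieldType) (A : cqg C).
Implicit Types (w v u a b : dual A) (g h : A) (x y : tens (dual A) (dual A)).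
Local Notation mulDD := (tmul (@dual_mul C A) (@dual_mul C A)).

Lemma lin_density (U : lmodType C) (F : U -> dual A) :
  linear F -> linear (fun z => density (F z)).
Proof. exact: lin_comp (@density_linear C A). Qed.

Lemma lin_haar_dual (U : lmodType C) (F : U -> A) :
  linear F -> linear (fun z => haar_dual (F z)).
Proof. exact: lin_comp (@haar_dual_linear C A). Qed.

(** Strong invariance in functional form. For scalar [f] it writes the convolution of [f] with [a]
    as a combination of the functionals [haar_dual k2], hence as an element of the dual even if [f]
    is not one. *)
Lemma dual_shiftr (V : lmodType C) a g (f : A -> V) : linear f ->
  \tsum_(g1, g2 <- comul g) (a g2 *: f g1) =
  \tsum_(k1, k2 <- comul (density a)) (haar_dual k2 g *: f (antipodeV k1)).
Proof.
move=> lf; have := congr1 f (haar_strong g (density a)).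
rewrite !(lin_tsum _ _ lf) => E.
transitivity (\tsum_(g1, g2 <- comul g) f (haar (g2 * density a) *: g1)).
  by apply: eq_tsum => g1 g2; rewrite linZ // dual_density.
by rewrite E; apply: eq_tsum => k1 k2; rewrite linZ // haar_dualE.
Qed.

Lemma dual_shiftl (V : lmodType C) a g (f : A -> V) : linear f ->
  \tsum_(g1, g2 <- comul g) (a g1 *: f g2) =
  \tsum_(k1, k2 <- comul (density a)) (haar_dual k1 g *: f (antipode k2)).
Proof.
move=> lf; have := congr1 f (haar_strongr g (density a)).
rewrite !(lin_tsum _ _ lf) => E.
transitivity (\tsum_(g1, g2 <- comul g) f (haar (g1 * density a) *: g2)).
  by apply: eq_tsum => g1 g2; rewrite linZ // dual_density.
by rewrite E; apply: eq_tsum => k1 k2; rewrite linZ // haar_dualE.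
Qed.

Definition eval2 g h x : C^o := \tsum_(u, v <- x) (u g * v h).

Lemma eval_lE g h x : eval_l g x h = eval2 g h x.
Proof.
rewrite /eval_l (lin_tsum (g := fun w : dual A => (w h : C^o))); last by lin.
by apply: eq_tsum => u v; rewrite (linZ (F := fun w : dual A => (w h : C^o))) //; lin.
Qed.

Lemma eval2_inj x y : (forall g h, eval2 g h x = eval2 g h y) -> x = y.
Proof.
by move=> e; apply: eval_l_inj => g; apply: dual_eq => h; rewrite !eval_lE.
Qed.

Lemma eval2_trilin : trilin eval2.
Proof. rewrite /eval2; lin. Qed.

Lemma lin_eval2 (U : lmodType C) g h (F : U -> tens (dual A) (dual A)) :
  linear F -> linear (fun z => eval2 g h (F z)).
Proof. by have [_ _ l] := eval2_trilin; apply: lin_comp (l g h). Qed.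

Lemma lin_eval2l (U : lmodType C) h x (F : U -> A) :
  linear F -> linear (fun z => eval2 (F z) h x).
Proof. by have [l _ _] := eval2_trilin; apply: lin_comp (l h x). Qed.

Lemma lin_eval2r (U : lmodType C) g x (F : U -> A) :
  linear F -> linear (fun z => eval2 g (F z) x).
Proof. by have [_ l _] := eval2_trilin; apply: lin_comp (l g x). Qed.

Lemma eval2_pure g h u v : eval2 g h (u ⊗ v) = u g * v h.
Proof. by rewrite /eval2 tsum_pure //; lin. Qed.

(* By strong invariance, these are the multiplications by the functional
   g ⊗ h |-> w(g h) on the two sides, written through densities. *)
Definition dual_comul_left w x : tens (dual A) (dual A) :=
  \tsum_(a, b <- x) \tsum_(k1, k2 <- comul (density a))
    \tsum_(l1, l2 <- comul (density b))
      (w (antipodeV k1 * antipodeV l1) *: (haar_dual k2 ⊗ haar_dual l2)).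

Definition dual_comul_right w x : tens (dual A) (dual A) :=
  \tsum_(a, b <- x) \tsum_(k1, k2 <- comul (density a))
    \tsum_(l1, l2 <- comul (density b))
      (w (antipode k2 * antipode l2) *: (haar_dual k1 ⊗ haar_dual l1)).

End DualComultiplicationFacts.

Ltac lin_extra ::= first
  [ apply: lin_dual_fun | apply: lin_dual | apply: lin_dual_mull | apply: lin_dual_mulr
  | apply: lin_density | apply: lin_haar_dual | apply: lin_eval_l
  | apply: lin_eval2 | apply: lin_eval2l | apply: lin_eval2r ].

Section DualComultiplicationExists.
Variables (C : numClosedFieldType) (A : cqg C).
Implicit Types (w v u a b : dual A) (g h : A) (x y : tens (dual A) (dual A)).
Local Notation mulDD := (tmul (@dual_mul C A) (@dual_mul C A)).

Lemma dual_comul_left_linear w : linear (dual_comul_left w).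
Proof. rewrite /dual_comul_left; lin. Qed.

Lemma dual_comul_right_linear w : linear (dual_comul_right w).
Proof. rewrite /dual_comul_right; lin. Qed.

Lemma eval2_dual_comul_left w g h x : eval2 g h (dual_comul_left w x) =
  \tsum_(g1, g2 <- comul g) \tsum_(h1, h2 <- comul h) (w (g1 * h1) * eval2 g2 h2 x).
Proof.
move: x; apply: tens_lin_eq => [||a b].
- by have := dual_comul_left_linear w; lin.
- lin.
rewrite /dual_comul_left tsum_pure; last by lin.
rewrite (lin_tsum (g := eval2 g h)); last by lin.
transitivity (\tsum_(g1, g2 <- comul g) (a g2 *:
    (\tsum_(h1, h2 <- comul h) (b h2 *: (w (g1 * h1) : C^o))))); last first.
  apply: eq_tsum => g1 g2; rewrite tsum_scaler; apply: eq_tsum => h1 h2.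
  by rewrite eval2_pure /GRing.scale /= [RHS]mulrC -[RHS]mulrA.
rewrite (dual_shiftr _ _ (f := fun g1 => \tsum_(h1, h2 <- comul h) (b h2 *: (w (g1 * h1) : C^o)))); last by lin.
apply: eq_tsum => k1 k2; rewrite (lin_tsum (g := eval2 g h)); last by lin.
rewrite (dual_shiftr _ _ (f := fun h1 => (w (antipodeV k1 * h1) : C^o))); last by lin.
rewrite tsum_scaler; apply: eq_tsum => l1 l2.
rewrite (linZ (F := eval2 g h)); last by lin.
by rewrite eval2_pure /GRing.scale /= [LHS]mulrC -[LHS]mulrA.
Qed.

Lemma eval2_dual_comul_right w g h x : eval2 g h (dual_comul_right w x) =
  \tsum_(g1, g2 <- comul g) \tsum_(h1, h2 <- comul h) (eval2 g1 h1 x * w (g2 * h2)).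
Proof.
move: x; apply: tens_lin_eq => [||a b].
- by have := dual_comul_right_linear w; lin.
- lin.
rewrite /dual_comul_right tsum_pure; last by lin.
rewrite (lin_tsum (g := eval2 g h)); last by lin.
transitivity (\tsum_(g1, g2 <- comul g) (a g1 *:
    (\tsum_(h1, h2 <- comul h) (b h1 *: (w (g2 * h2) : C^o))))); last first.
  apply: eq_tsum => g1 g2; rewrite tsum_scaler; apply: eq_tsum => h1 h2.
  by rewrite eval2_pure /GRing.scale /= mulrA.
rewrite (dual_shiftl _ _ (f := fun g2 => \tsum_(h1, h2 <- comul h) (b h1 *: (w (g2 * h2) : C^o)))); last by lin.
apply: eq_tsum => k1 k2; rewrite (lin_tsum (g := eval2 g h)); last by lin.
rewrite (dual_shiftl _ _ (f := fun h2 => (w (antipode k2 * h2) : C^o))); last by lin.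
rewrite tsum_scaler; apply: eq_tsum => l1 l2.
rewrite (linZ (F := eval2 g h)); last by lin.
by rewrite eval2_pure /GRing.scale /= [LHS]mulrC -[LHS]mulrA.
Qed.

Lemma eval2_mul g h x y : eval2 g h (mulDD x y) =
  \tsum_(g1, g2 <- comul g) \tsum_(h1, h2 <- comul h) (eval2 g1 h1 x * eval2 g2 h2 y).
Proof.
have [b1 b2] := tmul_bilin (dual_mul_bilin A) (dual_mul_bilin A).
move: y; apply: tens_lin_eq => [||v v'].
- by have := b2 x; lin.
- lin.
move: x; apply: tens_lin_eq => [||u u'].
- by have := b1 (v ⊗ v'); lin.
- lin.
rewrite tmul_pure ?eval2_pure; try exact: dual_mul_bilin.
rewrite !dual_mulE tsum_mulr; apply: eq_tsum => g1 g2.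
rewrite tsum_mull; apply: eq_tsum => h1 h2.
by rewrite !eval2_pure; rewrite mulrACA.
Qed.

(** Coassociativity of the coalgebra A ⊗ A, whose coproduct interleaves the legs of [g] and [h]. *)
Lemma coassoc2E (V : lmodType C) (F : A -> A -> A -> A -> A -> A -> V) g h :
  (forall h1 h2 h3, trilin (fun g1 g2 g3 => F g1 g2 g3 h1 h2 h3)) ->
  (forall g1 g2 g3, trilin (F g1 g2 g3)) ->
  \tsum_(u, g3 <- comul g) \tsum_(v, h3 <- comul h)
    \tsum_(g1, g2 <- comul u) \tsum_(h1, h2 <- comul v) F g1 g2 g3 h1 h2 h3 =
  \tsum_(g1, u <- comul g) \tsum_(h1, v <- comul h)
    \tsum_(g2, g3 <- comul u) \tsum_(h2, h3 <- comul v) F g1 g2 g3 h1 h2 h3.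
Proof.
move=> Fg Fh.
transitivity (\tsum_(u, g3 <- comul g) \tsum_(g1, g2 <- comul u)
   \tsum_(h1, v <- comul h) \tsum_(h2, h3 <- comul v) F g1 g2 g3 h1 h2 h3).
  apply: eq_tsum => u g3; rewrite exchange_tsum; apply: eq_tsum => g1 g2.
  by rewrite coassocE.
rewrite coassocE; last first.
  by split=> ? ?; apply: lin_tsum_fun => h1 v; apply: lin_tsum_fun => h2 h3;
     case: (Fg h1 h2 h3).
by apply: eq_tsum => g1 u; rewrite exchange_tsum.
Qed.

(** Evaluated at g ⊗ h, both operators are convolutions with the single functional g ⊗ h |-> w(g h),
    so the multiplier laws are instances of associativity of convolution. *)
Lemma dual_comul_exists w : is_multiplier mulDD (dual_comul_left w, dual_comul_right w).
Proof.
split=> /=; first exact: dual_comul_left_linear.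
- exact: dual_comul_right_linear.
- move=> x y; apply: eval2_inj => g h.
  rewrite eval2_dual_comul_left eval2_mul.
  transitivity (\tsum_(g1, u <- comul g) \tsum_(h1, v <- comul h)
    \tsum_(g2, g3 <- comul u) \tsum_(h2, h3 <- comul v)
      (w (g1 * h1) * eval2 g2 h2 x * eval2 g3 h3 y : C^o)).
    apply: eq_tsum => g1 u; apply: eq_tsum => h1 v.
    rewrite eval2_mul tsum_mull; apply: eq_tsum => g2 g3.
    by rewrite tsum_mull; apply: eq_tsum => h2 h3; rewrite mulrA.
  rewrite -coassoc2E; try by lin.
  apply: eq_tsum => u g3; apply: eq_tsum => v h3.
  rewrite eval2_dual_comul_left tsum_mulr; apply: eq_tsum => g1 g2.
  by rewrite tsum_mulr.
- move=> x y; apply: eval2_inj => g h.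
  rewrite eval2_dual_comul_right eval2_mul.
  transitivity (\tsum_(u, g3 <- comul g) \tsum_(v, h3 <- comul h)
    \tsum_(g1, g2 <- comul u) \tsum_(h1, h2 <- comul v)
      (eval2 g1 h1 x * eval2 g2 h2 y * w (g3 * h3) : C^o)).
    apply: eq_tsum => u g3; apply: eq_tsum => v h3.
    rewrite eval2_mul tsum_mulr; apply: eq_tsum => g1 g2.
    by rewrite tsum_mulr.
  rewrite coassoc2E; try by lin.
  apply: eq_tsum => g1 u; apply: eq_tsum => h1 v.
  rewrite eval2_dual_comul_right tsum_mull; apply: eq_tsum => g2 g3.
  by rewrite tsum_mull; apply: eq_tsum => h2 h3; rewrite mulrA.
- move=> x y; apply: eval2_inj => g h.
  rewrite !eval2_mul.
  transitivity (\tsum_(g1, u <- comul g) \tsum_(h1, v <- comul h)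
    \tsum_(g2, g3 <- comul u) \tsum_(h2, h3 <- comul v)
      (eval2 g1 h1 x * w (g2 * h2) * eval2 g3 h3 y : C^o)).
    apply: eq_tsum => g1 u; apply: eq_tsum => h1 v.
    rewrite eval2_dual_comul_left tsum_mull; apply: eq_tsum => g2 g3.
    by rewrite tsum_mull; apply: eq_tsum => h2 h3; rewrite mulrA.
  rewrite -coassoc2E; try by lin.
  apply: eq_tsum => u g3; apply: eq_tsum => v h3.
  rewrite eval2_dual_comul_right tsum_mulr; apply: eq_tsum => g1 g2.
  by rewrite tsum_mulr.
Qed.

Lemma dual_comulP w : is_multiplier mulDD (dual_comul w) /\
  forall g h u v, local_unit g u -> local_unit h v ->
    eval2 g h ((dual_comul w).1 (u ⊗ v)) = w (g * h).
Proof.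
rewrite /dual_comul; set S := (X in xget 0 X).
(* [xget] returns its default on an empty set, so the explicit density formula has to be supplied as
   an inhabitant. *)
apply: (@xgetPex _ 0 S); exists (dual_comul_left w, dual_comul_right w).
split; first exact: dual_comul_exists.
move=> g h u v gu hv; rewrite -[LHS]/(eval2 _ _ _) eval2_dual_comul_left.
transitivity (\tsum_(g1, g2 <- comul g) (u g2 *: (w (g1 * h) : C^o))).
  apply: eq_tsum => g1 g2; rewrite -(local_unit_tsum (f := fun t => (w (g1 * t) : C^o)) hv).
    rewrite tsum_scaler; apply: eq_tsum => h1 h2.
    by rewrite eval2_pure /GRing.scale /= [LHS]mulrC -[LHS]mulrA.
  lin.
by rewrite (local_unit_tsum (f := fun t => (w (t * h) : C^o)) gu) //; lin.
Qed.

(** The specification gives values at local units only. Writing [a] and [b] as products with local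
    units on the left extends it to all arguments by the multiplier law. *)
Lemma eval2_dual_comul w g h a b : eval2 g h ((dual_comul w).1 (a ⊗ b)) =
  \tsum_(g1, g2 <- comul g) \tsum_(h1, h2 <- comul h) (w (g1 * h1) * (a g2 * b h2)).
Proof.
have [mD Dw] := dual_comulP w.
have [u [ua ug]] := near_counit_ex (near_counit_and (near_dual_mul a)
  (near_counit_all (s := repr (comul g)) (fun p _ => near_local_unit p.1))).
have [v [vb vh]] := near_counit_ex (near_counit_and (near_dual_mul b)
  (near_counit_all (s := repr (comul h)) (fun p _ => near_local_unit p.1))).
rewrite -{1}ua -{1}vb -tmul_pure; try exact: dual_mul_bilin.
rewrite (mult_left mD) eval2_mul.
apply: eq_tsum_in => p ps; apply: eq_tsum_in => q qs.
by rewrite Dw ?eval2_pure //; [apply: ug|apply: vh].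
Qed.

Lemma dual_comul1E (w : dual A) x : (dual_comul w).1 x = dual_comul_left w x.
Proof.
move: x; apply: tens_lin_eq => [||a b].
- by have [mD _] := dual_comulP w; exact: mult_linear1 mD.
- exact: dual_comul_left_linear.
apply: eval2_inj => g h; rewrite eval2_dual_comul eval2_dual_comul_left.
by apply: eq_tsum => ? ?; apply: eq_tsum => ? ?; rewrite eval2_pure.
Qed.

(** The finite set collects the arguments at which [dual_comul_left] evaluates [w]. Once [w] is the
    counit there, the counit law for the two densities remains. *)
Lemma near_dual_comul a b : near_counit (fun w => (dual_comul w).1 (a ⊗ b) = a ⊗ b).
Proof.
exists [seq antipodeV p.1 * antipodeV q.1 | p <- (repr (comul (density a)) : seq (A * A)),
   q <- (repr (comul (density b)) : seq (A * A))] => w ws.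
rewrite dual_comul1E; transitivity (
    \tsum_(k1, k2 <- comul (density a)) \tsum_(l1, l2 <- comul (density b))
      ((counit k1 * counit l1) *: (haar_dual k2 ⊗ haar_dual l2))).
  rewrite /dual_comul_left tsum_pure; last by lin.
  apply: eq_tsum_in => p ps; apply: eq_tsum_in => q qs; congr (_ *: _).
  rewrite ws; first by rewrite counitM !counit_antipodeV.
  exact: (allpairs_f (fun p q : A * A => antipodeV p.1 * antipodeV q.1)).
rewrite -[in RHS](densityK a) -[in RHS](densityK b).
rewrite -[RHS](counitlE (f := fun k => haar_dual k ⊗ haar_dual (density b))); last by lin.
apply: eq_tsum => k1 k2.
rewrite -[in RHS](counitlE (f := fun l => haar_dual k2 ⊗ haar_dual l)); last by lin.
by rewrite tsum_scaler; apply: eq_tsum => l1 l2; rewrite scalerA.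
Qed.

End DualComultiplicationExists.

(** * The right action of O(G) *)

Section DualAction.
Variables (C : numClosedFieldType) (A : cqg C) (N : starAlgType C).
Variable thetah : {linear N -> multop (tens (dual A) N)}.
Hypothesis dual_action : is_dual_action thetah.
Implicit Types (g h : A) (m n : N).
Local Notation "m ◁ h" := (ract thetah m h) (at level 35).

Let thetah_mul m : is_multiplier (@dualN_mul C A N) (thetah m).
Proof. exact: thetah_mult dual_action m. Qed.

Lemma ract_linearr m : linear (ract thetah m).
Proof. exact: slice_linear (thetah_mul m). Qed.

Lemma thetah_linear1 x : linear (fun m => (thetah m).1 x).
Proof. by move=> k m n; rewrite linearP. Qed.

Lemma ract_linearl h : linear (fun m => m ◁ h).
Proof.
have l := thetah_linear1 (xget 0 [set u | local_unit h u]%classic ⊗ (1 : N)).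
by rewrite /ract /slice; lin.
Qed.

Lemma eval_thetah1 h m x :
  eval_l h ((thetah m).1 x) = \tsum_(a, b <- comul h) ((m ◁ a) * eval_l b x).
Proof. exact: eval_mult1. Qed.

Lemma eval_thetah2 h m x :
  eval_l h ((thetah m).2 x) = \tsum_(a, b <- comul h) (eval_l a x * (m ◁ b)).
Proof. exact: eval_mult2. Qed.

Lemma ract_unit h m u : local_unit h u -> m ◁ h = eval_l h ((thetah m).1 (u ⊗ (1 : N))).
Proof. exact: slice_unit. Qed.

(** The composite multiplier is evaluated at u ⊗ 1; the same [u] must be a local unit for [h] and
    for all right legs of its coproduct. *)
Lemma ractM m n h : (m * n) ◁ h = \tsum_(a, b <- comul h) ((m ◁ a) * (n ◁ b)).
Proof.
have [u [hu uh]] := near_counit_ex (near_counit_and (near_local_unit h)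
  (near_counit_all (s := repr (comul h)) (fun p _ => near_local_unit p.2))).
rewrite (ract_unit _ hu) (thetahM dual_action) /= eval_thetah1.
by apply: eq_tsum_in => p ps; rewrite [in RHS](ract_unit _ (uh p ps)).
Qed.

Lemma tsum_multop1 (B D V : lmodType C) (t : tens B D) (F : B -> D -> multop V) x :
  (tsum t F).1 x = \tsum_(a, b <- t) (F a b).1 x.
Proof.
rewrite /tsum /fsum; elim: (repr t) => [|p s IH]; first by rewrite !big_nil.
by rewrite !big_cons /= -IH.
Qed.

Lemma dual_comul_id_pure (y : tens (dual A) N) (a b : dual A) :
  (dual_comul_id y).1 (a ⊗ b ⊗ (1 : N)) =
  \tsum_(w, n <- y) (dual_comul_left w (a ⊗ b) ⊗ n).
Proof.
rewrite /dual_comul_id tsum_multop1; apply: eq_tsum => w n.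
have [mD _] := dual_comulP w.
rewrite /= tmap_pure; [|exact: mult_linear1 mD|exact: (amul_bilin N).2].
by rewrite dual_comul1E [amul n 1]mulr1.
Qed.

Lemma id_thetah_pure (y : tens (dual A) N) (a : dual A) (x : tens (dual A) N) :
  (id_thetah thetah y).1 (a ⊗ x) =
  \tsum_(w, n <- y) (dual_mul w a ⊗ (thetah n).1 x).
Proof.
rewrite /id_thetah tsum_multop1; apply: eq_tsum => w n.
rewrite /= tmap_pure //; first exact: (dual_mul_bilin A).2.
exact: mult_linear1 (thetah_mul n).
Qed.

(* Both multipliers of [thetah_coassoc] are evaluated at a ⊗ v ⊗ 1, with a and v
   local units for g and h, and u so close to the counit that u ⊗ 1 is absorbed. *)
Lemma ract_ract m g h : (m ◁ g) ◁ h = m ◁ (g * h).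
Proof.
have [a ga] := near_counit_ex (near_local_unit g).
have [v hv] := near_counit_ex (near_local_unit h).
have [u [[[ua gu] ghu] Du]] := near_counit_ex (near_counit_and (near_counit_and
  (near_counit_and (near_dual_mul a) (near_local_unit g)) (near_local_unit (g * h)))
  (near_dual_comul a v)).
have [U [U' [mU mU' UE U'E UU']]] := thetah_coassoc dual_action m.
have UE1 : U.1 (a ⊗ v ⊗ (1 : N)) =
    \tsum_(w, n <- (thetah m).1 (u ⊗ (1 : N))) (dual_comul_left w (a ⊗ v) ⊗ n).
  have [/(congr1 (fun T => T.1 (a ⊗ v ⊗ (1 : N))))/= + _] := UE (u ⊗ (1 : N)).
  rewrite !dual_comul_id_pure tsum_pure; last by rewrite /dual_comul_left; lin.
  by rewrite -dual_comul1E Du.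
have U'E1 : U'.1 (a ⊗ (v ⊗ (1 : N))) =
    \tsum_(w, n <- (thetah m).1 (u ⊗ (1 : N))) (dual_mul w a ⊗ (thetah n).1 (v ⊗ (1 : N))).
  have [/(congr1 (fun T => T.1 (a ⊗ (v ⊗ (1 : N)))))/= + _] := U'E (u ⊗ (1 : N)).
  rewrite !id_thetah_pure tsum_pure; last first.
    by have l := thetah_linear1 (v ⊗ (1 : N)); lin.
  by rewrite (thetah1 dual_action) ua.
have [+ _] := UU' (a ⊗ v ⊗ (1 : N)).
rewrite tassoc_pure UE1 U'E1 => /(congr1 (fun z => eval_l h (eval_l g z))).
have lassoc : linear (@tassoc C (dual A) (dual A) N) by rewrite /tassoc; lin.
rewrite (lin_tsum (g := fun z => eval_l h (eval_l g (tassoc z)))); last by lin.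
rewrite (lin_tsum (g := fun z => eval_l h (eval_l g z))); last by lin.
have evA x n : eval_l h (eval_l g (tassoc (x ⊗ n))) = eval2 g h x *: n.
  move: x; apply: tens_lin_eq => [||b c]; try by lin.
  rewrite tassoc_pure eval2_pure eval_l_pure (linZ _ _ ((eval_l_bilin A N).2 h)) /=.
  by rewrite eval_l_pure scalerA.
move=> E; symmetry; rewrite (ract_unit _ ghu).
transitivity (\tsum_(w, n <- (thetah m).1 (u ⊗ (1 : N)))
   eval_l h (eval_l g (tassoc (dual_comul_left w (a ⊗ v) ⊗ n)))).
  apply: eq_tsum => w n; rewrite evA -dual_comul1E.
  by rewrite (dual_comulP w).2.
rewrite E (ract_unit m gu) [eval_l g ((thetah m).1 _)]/eval_l (lin_tsum _ _ (ract_linearl h)).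
apply: eq_tsum => w n; rewrite eval_l_pure (linZ _ _ ((eval_l_bilin A N).2 h)).
rewrite (linZ _ _ (ract_linearl h)) -ract_unit //; congr (_ *: _).
(* The extra factor [a] disappears because it is a local unit for [g]. *)
rewrite dual_mulE -(local_unit_tsum (f := fun t => (w t : C^o)) ga); last by lin.
by apply: eq_tsum => g1 g2; apply: mulrC.
Qed.

Lemma star_one (B : starAlgType C) : star (1 : B) = 1.
Proof.
have st (y : B) : star (1 : B) * y = y.
  by apply: (can_inj (@starK C B)); rewrite [LHS]amul_star starK; apply: mulr1.
by rewrite -[LHS]mulr1 st.
Qed.

Lemma star_lin0 (B : starAlgType C) : star (0 : B) = 0.
Proof. by apply: (addrI (star 0)); rewrite -starD !addr0. Qed.

Lemma star_tsum (B D : lmodType C) (E : starAlgType C) (t : tens B D) (f : B -> D -> E) :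
  star (tsum t f) = \tsum_(a, b <- t) star (f a b).
Proof.
rewrite /tsum /fsum; elim: (repr t : seq _) => [|p s IH].
  by rewrite !big_nil star_lin0.
by rewrite !big_cons starD IH.
Qed.

(** The functional sending h to the conjugate of counit(star h) satisfies the left counit law, so it
    agrees with the counit. *)
Lemma counit_star h : counit (star h) = (counit h)^*.
Proof.
have -> : counit h = counit (\tsum_(a, b <- comul h) ((counit (star a))^* *: b)).
  congr (counit _); apply: (can_inj (@starK C A)); rewrite star_tsum.
  rewrite -[star h]counitl comul_star tsum_tmapE; last by lin.
  by apply: eq_tsum => a b; rewrite starZ conjCK.
rewrite -[h in LHS]counitr star_tsum !additive_tsum.
by apply: eq_tsum => a b /=; rewrite starZ !scalarZ /= rmorphM /= conjCK mulrC.
Qed.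

Lemma antipode_starK h : star (antipode (star (antipode h))) = h.
Proof. by rewrite antipode_starE starK antipodeK. Qed.

Lemma eval_tmap_star h (x : tens (dual A) N) :
  eval_l (star (antipode h)) (tmap (@dual_star C A) star x) = star (eval_l h x).
Proof.
rewrite /eval_l tsum_tmapE; last by lin.
rewrite star_tsum; apply: eq_tsum => w n; rewrite starZ; congr (_ *: _).
by rewrite -[LHS]/((w _)^*) antipode_starK.
Qed.

(** The involution of multipliers exchanges left and right parts, so the left part at star(m) is
    computed from [eval_thetah2] at [m]. Besides being a local unit, [u] must agree with the counit
    on the transformed left legs. *)
Lemma star_ract m h : star (m ◁ h) = star m ◁ star (antipode h).
Proof.
have nc : near_counit (fun u : dual A => forall p, p \in (repr (comul h) : seq (A * A)) ->
    u (star (antipode p.1)) = (counit p.1)^*).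
  exists [seq star (antipode p.1) | p <- (repr (comul h) : seq (A * A))] => u us p ps.
  rewrite us; last exact: (map_f (fun p : A * A => star (antipode p.1)) ps).
  by rewrite counit_star counit_antipode.
have [u [hu us]] := near_counit_ex (near_counit_and (near_local_unit (star (antipode h))) nc).
rewrite (ract_unit _ hu) (thetah_star dual_action) /= eval_tmap_star; congr star.
rewrite eval_thetah2 -[LHS](counitlE (f := ract thetah m)); last exact: ract_linearr.
apply: eq_tsum_in => p ps.
rewrite -[p.1 in RHS]antipode_starK eval_tmap_star eval_l_pure us // starZ conjCK.
by rewrite star_one amul_scaleAl mul1r.
Qed.

(** Pairing the invariance identity with [h], for every functional [w], and separating points gives
    mu(m ◁ h_(2)) h_(1) = mu(m) h; the counit is then applied. *)
Lemma invariant_ract (mu : {scalar N}) m h : thetah_invariant thetah mu ->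
  mu (m ◁ h) = counit h * mu m.
Proof.
move=> inv.
have : \tsum_(a, b <- comul h) (mu (m ◁ b) *: a) = mu m *: h.
  apply: dual_sep => w; rewrite (linZ _ _ (dual_linear w)).
  have /(congr1 (fun v : dual A => (v h : C^o))) := inv w m.
  rewrite (lin_tsum (g := fun v : dual A => (v h : C^o))); last by lin.
  rewrite [in RHS](linZ (F := fun v : dual A => (v h : C^o))); last by lin.
  move=> <-; transitivity (mu (eval_l h ((thetah m).2 (w ⊗ (1 : N))))).
    rewrite eval_thetah2 (lin_tsum _ _ (dual_linear w)) additive_tsum.
    apply: eq_tsum => a b /=; rewrite eval_l_pure amul_scaleAl mul1r scalarZ.
    by rewrite (linZ _ _ (dual_linear w)); apply: mulrC.
  rewrite additive_tsum; apply: eq_tsum => v n.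
  by rewrite (linZ (F := fun v : dual A => (v h : C^o))) /= ?scalarZ; [apply: mulrC|lin].
move=> /(congr1 counit); rewrite scalarZ additive_tsum => E.
rewrite mulrC -E -[LHS](counitlE (f := fun b => (mu (m ◁ b) : C^o))); last first.
  by apply: lin_scalar; exact: ract_linearr.
by apply: eq_tsum => a b /=; rewrite scalarZ; apply: mulrC.
Qed.

End DualAction.

(** * The maps gamma *)

Lemma lin_ractl (C : numClosedFieldType) (A : cqg C) (N : starAlgType C)
    (thetah : {linear N -> multop (tens (dual A) N)}) (U : lmodType C) (F : U -> N) h :
  is_dual_action thetah -> linear F -> linear (fun z => ract thetah (F z) h).
Proof. by move=> hA; apply: lin_comp (ract_linearl thetah h). Qed.

Lemma lin_ractr (C : numClosedFieldType) (A : cqg C) (N : starAlgType C)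
    (thetah : {linear N -> multop (tens (dual A) N)}) (U : lmodType C) (F : U -> A) m :
  is_dual_action thetah -> linear F -> linear (fun z => ract thetah m (F z)).
Proof. by move=> hA; apply: lin_comp (ract_linearr hA m). Qed.

Ltac lin_extra ::= match goal with
  | |- _ (fun x => ract _ ?m _) => let T := type of m in apply: lin_ractr
  | |- _ (fun x => ract _ _ _) => apply: lin_ractl
  | |- _ (fun x => dual_val _ _) => first [apply: lin_dual_fun | apply: lin_dual]
  | |- _ (fun x => eval_l _ _) => first [apply: lin_eval_l | apply: lin_eval_arg]
  end.

Section YetterDrinfeldAutomorphisms.
Variables (C : numClosedFieldType) (A : cqg C) (N : starAlgType C).
Variable thetah : {linear N -> multop (tens (dual A) N)}.
Variable theta : {linear N -> tens A N}.
Hypothesis YD : is_braided_commutative_YD thetah theta.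
Implicit Types (g h a b : A) (m n : N).
Local Notation "m ◁ h" := (ract thetah m h) (at level 35).
Local Notation S := antipode.
Local Notation SV := antipodeV.
Local Notation ga := (gamma thetah theta).
Local Notation gah := (gammah thetah theta).

Let hA : is_dual_action thetah := YD_thetah YD.

Lemma gamma_linear : linear ga.
Proof. have h := hA; rewrite /gamma; lin. Qed.

Lemma gammah_linear : linear gah.
Proof. have h := hA; rewrite /gammah; lin. Qed.

Lemma theta_coassocE (V : lmodType C) (f : A -> A -> N -> V) m : trilin f ->
  \tsum_(u, n <- theta m) \tsum_(a, b <- comul u) f a b n =
  \tsum_(a, n <- theta m) \tsum_(b, n' <- theta n) f a b n'.
Proof.
move=> tf; have := tassoc_tsum (tmap comul id (theta m)) tf.
rewrite (theta_coassoc (YD_theta YD)) !tsum_tmapE; last by lin.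
  by move=> ->; apply: eq_tsum.
by case: tf => f1 f2 f3; split=> *; lin; split.
Qed.

Lemma theta_counitE m : \tsum_(a, n <- theta m) (counit a *: n) = m.
Proof. exact: theta_counit (YD_theta YD) m. Qed.

Lemma theta_ractE (V : lmodType C) (F : A -> N -> V) m h : bilin F ->
  tsum (theta (m ◁ h)) F =
  \tsum_(h1, h23 <- comul h) \tsum_(h2, h3 <- comul h23)
     \tsum_(a, n <- theta m) F (SV h3 * a * h1) (n ◁ h2).
Proof.
move=> bF; rewrite (YD_compat YD) tsum_tsumE //; apply: eq_tsum => h1 h23.
rewrite tsum_tsumE //; apply: eq_tsum => h2 h3.
by rewrite tsum_tsumE //; apply: eq_tsum => a n; rewrite tsum_pure.
Qed.

Lemma theta_gamma m : theta (ga m) = \tsum_(a, n <- theta m) (SV (SV a) ⊗ ga n).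
Proof.
rewrite /gamma linear_tsum.
pose G a b n : tens A N := \tsum_(x, y <- comul a) \tsum_(z, w <- comul x)
  ((SV (SV z) * (b * SV y)) ⊗ (n ◁ SV w)).
transitivity (\tsum_(a, m0 <- theta m) \tsum_(b, n <- theta m0) G a b n).
  apply: eq_tsum => a m0; rewrite (YD_compat YD) comul_antipodeVE; last by lin.
  rewrite exchange_tsum; apply: eq_tsum => x y.
  rewrite comul_antipodeVE; last by lin.
  rewrite exchange_tsum; apply: eq_tsum => z w.
  by apply: eq_tsum => b n; rewrite mulrA.
rewrite -theta_coassocE; last by rewrite /G; lin.
transitivity (\tsum_(a, n <- theta m) \tsum_(z, w <- comul a)
   (SV (SV z) ⊗ (n ◁ SV w))); last first.
  rewrite theta_coassocE; last by lin.
  apply: eq_tsum => z n; rewrite [RHS](lin_tsum (g := fun y => SV (SV z) ⊗ y)) //.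
  lin.
apply: eq_tsum => a n; rewrite /G coassocE; last by lin.
rewrite -[RHS](counitrE (f := fun x => \tsum_(z, w <- comul x) _)); last by lin.
apply: eq_tsum => x u; rewrite exchange_tsum tsum_scaler; apply: eq_tsum => z w.
rewrite -(lin_tsum (g := fun y => (SV (SV z) * y) ⊗ (n ◁ SV w))); last by lin.
rewrite antipodeVr (linZ (F := fun y => (SV (SV z) * y) ⊗ _)) ?mulr1 //; lin.
Qed.

(** S^2 preserves the order of the legs, so S^-1 of the third one is S(y), to the left of [b]. The
    cancelling product is S(y) b, by the antipode law itself instead of its form for S^-1. *)
Lemma theta_gammah m : theta (gah m) = \tsum_(a, n <- theta m) (S (S a) ⊗ gah n).
Proof.
rewrite /gammah linear_tsum.
pose G a b n : tens A N := \tsum_(x, y <- comul a) \tsum_(z, w <- comul x)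
  ((S y * b * S (S z)) ⊗ (n ◁ S (S w))).
transitivity (\tsum_(a, m0 <- theta m) \tsum_(b, n <- theta m0) G a b n).
  apply: eq_tsum => a m0; rewrite (YD_compat YD).
  do 2! [rewrite comul_antipodeE; last by lin].
  transitivity (\tsum_(z, u <- comul a) \tsum_(w, y <- comul u)
    \tsum_(b, n <- theta m0) ((S y * b * S (S z)) ⊗ (n ◁ S (S w)))).
    apply: eq_tsum => z u; do 2! [rewrite comul_antipodeE; last by lin].
    by apply: eq_tsum => w y; apply: eq_tsum => b n; rewrite antipodeK.
  rewrite -coassocE; last by lin.
  rewrite exchange_tsum; apply: eq_tsum => x y.
  by rewrite exchange_tsum; apply: eq_tsum => z w.
rewrite -theta_coassocE; last by rewrite /G; lin.
transitivity (\tsum_(a, n <- theta m) \tsum_(z, w <- comul a)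
   (S (S z) ⊗ (n ◁ S (S w)))); last first.
  rewrite theta_coassocE; last by lin.
  apply: eq_tsum => z n; rewrite [RHS](lin_tsum (g := fun y => S (S z) ⊗ y)) //.
  lin.
apply: eq_tsum => a n; rewrite /G coassocE; last by lin.
rewrite -[RHS](counitrE (f := fun x => \tsum_(z, w <- comul x) _)); last by lin.
apply: eq_tsum => x u; rewrite exchange_tsum tsum_scaler; apply: eq_tsum => z w.
rewrite -(lin_tsum (g := fun y : A => (y * S (S z)) ⊗ (n ◁ S (S w)))); last by lin.
rewrite antipodel (linZ (F := fun y : A => (y * S (S z)) ⊗ _)) ?mul1r //; lin.
Qed.

Lemma theta_gammaE (V : lmodType C) (F : A -> N -> V) m : bilin F ->
  tsum (theta (ga m)) F = \tsum_(a, n <- theta m) F (SV (SV a)) (ga n).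
Proof.
move=> bF; rewrite theta_gamma tsum_tsumE //.
by apply: eq_tsum => a n; rewrite tsum_pure.
Qed.

Lemma theta_gammahE (V : lmodType C) (F : A -> N -> V) m : bilin F ->
  tsum (theta (gah m)) F = \tsum_(a, n <- theta m) F (S (S a)) (gah n).
Proof.
move=> bF; rewrite theta_gammah tsum_tsumE //.
by apply: eq_tsum => a n; rewrite tsum_pure.
Qed.

(** The exponent 2 in [gammah] undoes the S^-2 in the involution of G^c: both sides become a sum of
    star(n) ◁ star(a). *)
Lemma star_gamma m : star (ga m) = gah (star m).
Proof.
have h := hA; rewrite /gamma /gammah star_tsum (theta_star (YD_theta YD)) tsum_tmapE; last by lin.
by apply: eq_tsum => a n; rewrite star_ract // antipodeVK /op_star !antipodeVK.
Qed.

(** The Yetter-Drinfeld condition produces h_(2) S^-1(h_(1)) at the front of the acting element,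
    which collapses to a counit. For [gammah] the corresponding product is h_(2) S(h_(3)). *)
Lemma gamma_ract m h : ga (m ◁ h) = ga m ◁ SV (SV h).
Proof.
have hA' := hA; rewrite /gamma theta_ractE; last by lin.
rewrite (lin_tsum _ _ (ract_linearl thetah _)).
transitivity (\tsum_(a, n <- theta m) \tsum_(h1, h23 <- comul h)
   \tsum_(h2, h3 <- comul h23) (n ◁ ((h2 * SV h1) * (SV a * SV (SV h3))))).
  rewrite [RHS]exchange_tsum; apply: eq_tsum => h1 h23.
  rewrite [RHS]exchange_tsum; apply: eq_tsum => h2 h3.
  by apply: eq_tsum => a n; rewrite ract_ract // !antipodeVM !mulrA.
apply: eq_tsum => a n; rewrite -coassocE; last by lin.
rewrite ract_ract // -[RHS](counitlE (f := fun x => n ◁ (SV a * SV (SV x)))); last by lin.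
apply: eq_tsum => u h3.
rewrite -(lin_tsum (g := fun y : A => n ◁ (y * (SV a * SV (SV h3))))); last by lin.
by rewrite antipodeVr (linZ (F := fun y : A => n ◁ (y * _))) ?mul1r //; lin.
Qed.

Lemma gammah_ract m h : gah (m ◁ h) = gah m ◁ S (S h).
Proof.
have hA' := hA; rewrite /gammah theta_ractE; last by lin.
rewrite (lin_tsum _ _ (ract_linearl thetah _)).
transitivity (\tsum_(a, n <- theta m) \tsum_(h1, h23 <- comul h)
   \tsum_(h2, h3 <- comul h23) (n ◁ ((h2 * S h3) * (S (S a) * S (S h1))))).
  rewrite [RHS]exchange_tsum; apply: eq_tsum => h1 h23.
  rewrite [RHS]exchange_tsum; apply: eq_tsum => h2 h3.
  by apply: eq_tsum => a n; rewrite ract_ract // !antipodeM antipodeVK !mulrA.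
apply: eq_tsum => a n.
rewrite ract_ract // -[RHS](counitrE (f := fun x => n ◁ (S (S a) * S (S x)))); last by lin.
apply: eq_tsum => h1 u.
rewrite -(lin_tsum (g := fun y : A => n ◁ (y * (S (S a) * S (S h1))))); last by lin.
by rewrite antipoder (linZ (F := fun y : A => n ◁ (y * _))) ?mul1r //; lin.
Qed.

(** The second braiding law is the suitable one: its S turns the S^-2 of [theta_gamma] into S^-1,
    and the reversed coproduct of S^-1(a) recombines the two factors. For [gammah] the first law,
    which carries no antipode, fits S^2. *)
Lemma ract_gamma m n : \tsum_(a, m0 <- theta m) ((m0 * n) ◁ SV a) = n * ga m.
Proof.
have h := hA; have lg := gamma_linear.
rewrite (YD_braidr YD) theta_gammaE; last by lin.
transitivity (\tsum_(u, m0 <- theta m) \tsum_(a, b <- comul u)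
   ((m0 ◁ SV b) * (n ◁ SV a))).
  apply: eq_tsum => u m0; rewrite ractM // comul_antipodeVE //; lin.
rewrite theta_coassocE; last by lin.
by apply: eq_tsum => a m0; rewrite antipodeVK /gamma tsum_mulr.
Qed.

Lemma ract_gammah m n : \tsum_(a, m0 <- theta m) ((n * m0) ◁ S (S a)) = gah m * n.
Proof.
have h := hA; have lg := gammah_linear.
rewrite (YD_braidl YD) theta_gammahE; last by lin.
transitivity (\tsum_(u, m0 <- theta m) \tsum_(a, b <- comul u)
   ((n ◁ S (S a)) * (m0 ◁ S (S b)))).
  apply: eq_tsum => u m0; rewrite ractM //.
  by do 2! [rewrite comul_antipodeE; last by lin].
rewrite theta_coassocE; last by lin.
by apply: eq_tsum => a m0; rewrite /gammah tsum_mull.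
Qed.

(** The S^2 of [gammah] cancels the S^-2 of [theta_gamma], leaving S^-1(b) a with [a], [b]
    consecutive legs. In the opposite order the acting element is S^2(b) S(a) = S(a S(b)). *)
Lemma gammaK : cancel ga gah.
Proof.
move=> m; have h := hA; rewrite /gammah theta_gammaE; last by lin.
transitivity (\tsum_(u, n <- theta m) \tsum_(a, b <- comul u) (n ◁ (SV b * a))).
  rewrite theta_coassocE; last by lin.
  apply: eq_tsum => a n; rewrite /gamma (lin_tsum _ _ (ract_linearl thetah _)).
  by apply: eq_tsum => b n'; rewrite ract_ract // !antipodeVK.
rewrite -[RHS]theta_counitE; apply: eq_tsum => u n.
rewrite -(lin_tsum _ _ (ract_linearr h n)) antipodeVl (linZ _ _ (ract_linearr h n)).
by rewrite (thetah_counit h).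
Qed.

Lemma gammahK : cancel gah ga.
Proof.
move=> m; have h := hA; rewrite /gamma theta_gammahE; last by lin.
transitivity (\tsum_(u, n <- theta m) \tsum_(a, b <- comul u) (n ◁ S (a * S b))).
  rewrite theta_coassocE; last by lin.
  apply: eq_tsum => a n; rewrite /gammah (lin_tsum _ _ (ract_linearl thetah _)).
  by apply: eq_tsum => b n'; rewrite ract_ract // antipodeK antipodeM.
rewrite -[RHS]theta_counitE; apply: eq_tsum => u n.
rewrite -(lin_tsum (g := fun y => n ◁ S y)); last by lin.
rewrite antipoder (linZ (F := fun y => n ◁ S y)); last by lin.
by rewrite antipode1 (thetah_counit h).
Qed.

Lemma theta_mulE (V : lmodType C) (F : A -> N -> V) m n : bilin F ->
  tsum (theta (m * n)) F =
  \tsum_(a, m0 <- theta m) \tsum_(b, n0 <- theta n) F (b * a) (m0 * n0).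
Proof.
move=> bF; rewrite (thetaM (YD_theta YD)) tsum_tmul //.
exact: bilin_balanced.
Qed.

(** Two uses of [ract_gamma] give the action of S^-1(a) S^-1(b) on m0 n0. This is S^-1(b a), and b a
    is the product that [theta] forms, being valued in the opposite algebra. *)
Lemma gammaM m n : ga (m * n) = ga m * ga n.
Proof.
have h := hA; rewrite {1}/gamma theta_mulE; last by lin.
rewrite exchange_tsum -ract_gamma; apply: eq_tsum => b n0.
rewrite -ract_gamma (lin_tsum _ _ (ract_linearl thetah _)).
by apply: eq_tsum => a m0; rewrite ract_ract // antipodeVM.
Qed.

Lemma gammahM m n : gah (m * n) = gah m * gah n.
Proof.
have h := hA; rewrite {1}/gammah theta_mulE; last by lin.
rewrite -ract_gammah; apply: eq_tsum => a m0.
rewrite -ract_gammah (lin_tsum _ _ (ract_linearl thetah _)).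
by apply: eq_tsum => b n0; rewrite ract_ract // !antipodeM.
Qed.

(** Used with [s] equal to S^2 and to S^-2. After evaluation at [h], [sE] matches the coproducts and
    [Gs] the slices, so compatibility with the action gives compatibility with the multipliers. *)
Lemma mult_extends_twist (D : dual A -> dual A) (s : A -> A) (G : N -> N) m :
  linear D -> linear s -> linear G -> {morph G : m n / m * n} ->
  (forall w h, D w h = w (s h)) ->
  (forall h, comul (s h) = tmap s s (comul h)) ->
  (forall n h, G (n ◁ s h) = G n ◁ h) ->
  mult_extends (fun x => mult_of (@dualN_mul _ A N) (tmap D G x)) (thetah m) (thetah (G m)).
Proof.
move=> lD ls lG GM DE sE Gs.
have evF h x : eval_l h (tmap D G x) = G (eval_l (s h) x).
  rewrite /eval_l tsum_tmapE; last by lin.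
  by rewrite (lin_tsum _ _ lG); apply: eq_tsum => w n; rewrite DE linZ.
have mT n := thetah_mult hA n.
have T1 x : (thetah (G m)).1 (tmap D G x) = tmap D G ((thetah m).1 x).
  apply: eval_l_inj => h; rewrite evF !eval_thetah1 //; try exact: hA.
  rewrite sE tsum_tmapE; last by have hA' := hA; lin.
  by rewrite (lin_tsum _ _ lG); apply: eq_tsum => a b; rewrite GM Gs evF.
have T2 x : (thetah (G m)).2 (tmap D G x) = tmap D G ((thetah m).2 x).
  apply: eval_l_inj => h; rewrite evF !eval_thetah2 //; try exact: hA.
  rewrite sE tsum_tmapE; last by have hA' := hA; lin.
  by rewrite (lin_tsum _ _ lG); apply: eq_tsum => a b; rewrite GM Gs evF.
(* Since [thetah (G m)] intertwines with [tmap D G] on both sides, only the multiplier laws are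
   needed to move it past a product. *)
move=> v; split; congr pair; apply: funext => x /=.
- by rewrite (mult_left (mT _)) T1.
- by rewrite -T1 (mult_compat (mT _)).
- by rewrite (mult_compat (mT _)) T2.
- by rewrite (mult_right (mT _)) T2.
Qed.

Lemma dact_gamma m (w : dual A) :
  ga (dact theta m w) = dact theta (ga m) (dual_antipode (dual_antipode w)).
Proof.
rewrite /dact (lin_tsum _ _ gamma_linear) theta_gammaE; last by lin.
apply: eq_tsum => a n; rewrite (linZ _ _ gamma_linear); congr (_ *: _).
by rewrite -[RHS]/(w _) !antipodeVK.
Qed.

Lemma dact_gammah m (w : dual A) :
  gah (dact theta m w) = dact theta (gah m) (dual_antipodeV (dual_antipodeV w)).
Proof.
rewrite /dact (lin_tsum _ _ gammah_linear) theta_gammahE; last by lin.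
apply: eq_tsum => a n; rewrite (linZ _ _ gammah_linear); congr (_ *: _).
by rewrite -[RHS]/(w _) !antipodeK.
Qed.

(** Under [mu] the action of S^-1(a) in [ract_gamma] becomes the scalar counit(a), and the counit
    law of [theta] restores [m]. *)
Lemma invariant_gamma_trace (mu : {scalar N}) m n : thetah_invariant thetah mu ->
  mu (m * n) = mu (n * ga m).
Proof.
move=> inv; rewrite -ract_gamma additive_tsum -{1}[m]theta_counitE tsum_mulr additive_tsum.
apply: eq_tsum => a m0 /=; rewrite amul_scaleAl scalarZ.
by rewrite (invariant_ract hA) // counit_antipodeV.
Qed.

Lemma invariant_gammah_trace (mu : {scalar N}) m n : thetah_invariant thetah mu ->
  mu (m * n) = mu (gah n * m).
Proof.
move=> inv; rewrite -ract_gammah additive_tsum -{1}[n]theta_counitE tsum_mull additive_tsum.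
apply: eq_tsum => a m0 /=; rewrite amul_scaleAr scalarZ.
by rewrite (invariant_ract hA) // !counit_antipode.
Qed.

End YetterDrinfeldAutomorphisms.

(** Each antipode reverses the two legs, so its square is a coalgebra map. *)
Lemma comul_antipode2 (C : numClosedFieldType) (H : hopfStarAlg C) (x : H) :
  comul (antipode (antipode x)) =
  tmap (fun h => antipode (antipode h)) (fun h => antipode (antipode h)) (comul x).
Proof.
rewrite -[LHS]tsum_id; do 2! [rewrite comul_antipodeE; last by lin].
by [].
Qed.

Lemma comul_antipodeV2 (C : numClosedFieldType) (H : hopfStarAlg C) (x : H) :
  comul (antipodeV (antipodeV x)) =
  tmap (fun h => antipodeV (antipodeV h)) (fun h => antipodeV (antipodeV h)) (comul x).
Proof.
rewrite -[LHS]tsum_id; do 2! [rewrite comul_antipodeVE; last by lin].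
by [].
Qed.

Theorem theorem3p4 (R : realType) (A : cqg R[i]) (N : starAlgType R[i])
  (theta : {linear N -> tens A N})
  (thetah : {linear N -> multop (tens (dual A) N)})
  (YD : is_braided_commutative_YD thetah theta) :
  let ga := gamma thetah theta in
  let gah := gammah thetah theta in
  (* linearity of gamma_theta and \hat gamma_theta *)
  (forall (k : R[i]) (m n : N), ga (k *: m + n) = k *: ga m + ga n) /\
  (forall (k : R[i]) (m n : N), gah (k *: m + n) = k *: gah m + gah n) /\
  (* CA1 *)
  ((forall m : N, star (ga m) = gah (star m)) /\
   (forall m : N, theta (ga m) =
      tmap (fun h => op_antipode (op_antipode h)) ga (theta m)) /\
   (forall m : N, theta (gah m) =
      tmap (fun h => op_antipodeV (op_antipodeV h)) gah (theta m))) /\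
  (* CA2 *)
  (forall (m : N) (h : A), ga (ract thetah m h) =
      ract thetah (ga m) (antipodeV (antipodeV h)) /\
    gah (ract thetah m h) = ract thetah (gah m) (antipode (antipode h))) /\
  (* CA3 *)
  (forall m n : N,
    \tsum_(a, m0 <- theta m) ract thetah (m0 * n) (antipodeV a) = n * ga m /\
    \tsum_(a, m0 <- theta m) ract thetah (n * m0) (antipode (antipode a)) =
      gah m * n) /\
  (* CA4 *)
  (forall m : N, ga (gah m) = m /\ gah (ga m) = m) /\
  (* CA5 *)
  (forall m n : N, ga (m * n) = ga m * ga n /\ gah (m * n) = gah m * gah n) /\
  (* CA6 *)
  (forall m : N, ga (star (ga (star m))) = m /\ gah (star (gah (star m))) = m) /\
  (* CA7 *)
  (forall m : N,
    mult_extends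
      (fun x => mult_of (@dualN_mul _ A N)
         (tmap (fun w => dual_antipode (dual_antipode w)) ga x))
      (thetah m) (thetah (ga m)) /\
    mult_extends
      (fun x => mult_of (@dualN_mul _ A N)
         (tmap (fun w => dual_antipodeV (dual_antipodeV w)) gah x))
      (thetah m) (thetah (gah m))) /\
  (* CA8 *)
  (forall (m : N) (w : dual A),
    ga (dact theta m w) = dact theta (ga m) (dual_antipode (dual_antipode w)) /\
    gah (dact theta m w) =
      dact theta (gah m) (dual_antipodeV (dual_antipodeV w))) /\
  (* CA9 *)
  (forall mu : {scalar N}, (exists m : N, mu m != 0) -> thetah_invariant thetah mu ->
    (forall m : N, mu m = mu (ga m) /\ mu m = mu (gah m)) /\
    (forall m n : N, mu (m * n) = mu (n * ga m) /\ mu (m * n) = mu (gah n * m))).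
Proof.
move=> ga gah.
have gaM : {morph ga : m n / m * n} by exact: gammaM.
have gahM : {morph gah : m n / m * n} by exact: gammahM.
split; first exact: gamma_linear.
split; first exact: gammah_linear.
split.
  by split; [exact: star_gamma|split; [exact: theta_gamma|exact: theta_gammah]].
split; first by move=> m h; split; [exact: gamma_ract|exact: gammah_ract].
split; first by move=> m n; split; [exact: ract_gamma|exact: ract_gammah].
split; first by move=> m; split; [exact: gammahK|exact: gammaK].
split; first by move=> m n; split; [exact: gammaM|exact: gammahM].
split.
  (* Moving the star across the inner map replaces it by its hatted or unhatted counterpart, which
     is the inverse of the outer one. *)
  move=> m; split; first by rewrite /ga star_gamma // starK gammahK.
  by rewrite -[gah (star m)](star_gamma YD) starK; exact: (gammaK YD).
split.
  move=> m; split.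
    apply: (mult_extends_twist YD (s := fun h => antipode (antipode h))) => //; try by lin.
    - by move=> k w v; apply: dual_eq => g; rewrite !dualP.
    - exact: gamma_linear.
    - exact: comul_antipode2.
    - by move=> n h; apply: etrans (gamma_ract YD _ _) _; rewrite !antipodeK.
  apply: (mult_extends_twist YD (s := fun h => antipodeV (antipodeV h))) => //; try by lin.
  - by move=> k w v; apply: dual_eq => g; rewrite !dualP.
  - exact: gammah_linear.
  - exact: comul_antipodeV2.
  - by move=> n h; apply: etrans (gammah_ract YD _ _) _; rewrite !antipodeVK.
split; first by move=> m w; split; [exact: dact_gamma|exact: dact_gammah].
move=> mu _ inv; split=> [m|m n]; last first.
  by split; [exact: invariant_gamma_trace|exact: invariant_gammah_trace].
(* Invariance under the two maps is the twisted trace property with one factor equal to 1. *)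
split; first by rewrite -[m in LHS]mulr1 (invariant_gamma_trace YD) // mul1r.
by rewrite -[m in LHS]mul1r (invariant_gammah_trace YD) // mulr1.
Qed.
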